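(* Assume $\dim M=1$. Then for all $\mu\in\mathcal M_0(M)$, $\mu\ne0$, and all $\varphi,\psi\in C_c^\infty(M)\subset T_\mu^{\mathsf{ana}}\mathcal M_0$ with $\Lambda>0$, $$\mathsf{Sec}_\mu^\uparrow(\varphi,\psi)=0.$$
   Context: $(M,g)$ is a smooth Riemannian manifold without boundary, not necessarily complete, with Riemannian distance $d$. $\mathcal M_0(M)$ is the set of finite Borel measures on $M$. Cone: $C=(M\times[0,\infty))/\!\sim$, where $(x,r)\sim(x',r')$ iff they are equal or $r=r'=0$, with metric $d_C((x,r),(x',r'))^2=r^2+r'^2-2rr'\cos(\min(d(x,x'),\pi))$. For $r>0$, the tangent space at $(x,r)$ is $T_xM\times\mathbb R$ with $|(v,s)|^2_{(x,r)}=r^2|v|_x^2+s^2$, and for $s>-r$, $|v|<(1+s/r)\pi/2$, $$\exp^C_{(x,r)}(v,s)=\Big(\exp^M_x\Big(\arctan\Big(\tfrac{r|v|}{r+s}\Big)\tfrac{v}{|v|}\Big),\sqrt{(r+s)^2+r^2|v|^2}\Big)$$ (first component $x$ if $v=0$). For $\mu\ne0$ put $r_\mu=\sqrt{\mu(M)}$ and $\hat\mu=\frac1{r_\mu^2}\,\mu\otimes\delta_{r_\mu}$, a probability measure on $C$. $T^{\mathsf{ana}}_\mu\mathcal M_0=H^1(\mu)$ is the closure of $C_c^\infty(M)$ with respect to $\|\varphi\|^2_{H^1(\mu)}=\int_M(|\nabla\varphi|^2+4\varphi^2)\,d\mu$, with corresponding inner product $\langle\cdot,\cdot\rangle_{H^1(\mu)}$,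 and $\Lambda=\|\varphi\|^2_{H^1(\mu)}\|\psi\|^2_{H^1(\mu)}-\langle\varphi,\psi\rangle^2_{H^1(\mu)}$. $\lim^{*}_{s,t\to0}F(s,t)=L$ means $F(s_j,t_j)\to L$ for every sequence in $(0,\infty)^2$ with $s_j,t_j\to0$ and $\sup_j(s_j/t_j+t_j/s_j)<\infty$. The lifted part of the sectional curvature of $(\mathcal M_0(M),\mathsf{HK})$ ($\mathsf{HK}$ the Hellinger-Kantorovich metric) is $$\mathsf{Sec}^\uparrow_\mu(\varphi,\psi)=\lim^{*}_{s,t\to0}\frac{3}{\Lambda s^2t^2}\Big[\|s\varphi-t\psi\|^2_{H^1(\mu)}-\int_C d_C^2\Big(\exp^C_{(x,r)}\big(s(\nabla\varphi,2r\varphi)\big),\exp^C_{(x,r)}\big(t(\nabla\psi,2r\psi)\big)\Big)\,d\hat\mu(x,r)\Big].$$ *)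

(* Defs.v *)
From HB Require Import structures.
From mathcomp Require Import all_boot all_order all_algebra.
From mathcomp Require Import generic_quotient.
From mathcomp Require Import all_classical all_reals all_analysis.

Set Implicit Arguments.
Unset Strict Implicit.
Unset Printing Implicit Defensive.

Import Order.TTheory GRing.Theory Num.Theory.
Import numFieldNormedType.Exports.

Local Open Scope classical_set_scope.
Local Open Scope ring_scope.

Definition smooth_on (R : realType) (U : set R) (f : R -> R) : Prop :=
  forall (n : nat) (u : R), U u -> derivable (derive1n n f) u 1.

Record chart (R : realType) (M : topologicalType) := Chart {
  cdom : set M ;
  cimg : set R ;
  cmap : M -> R ;
  cinv : R -> M ;
  cdom_open : open cdom ;
  cimg_open : open cimg ;
  cmap_img : forall x, cdom x -> cimg (cmap x) ;
  cinv_dom : forall u, cimg u -> cdom (cinv u) ;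
  cmapK : forall x, cdom x -> cinv (cmap x) = x ;
  cinvK : forall u, cimg u -> cmap (cinv u) = u ;
  cmap_continuous : forall x, cdom x -> {for x, continuous cmap} ;
  cinv_continuous : forall u, cimg u -> {for u, continuous cinv}
}.

(* A smooth Riemannian manifold of dimension 1, without boundary; neither
   connectedness nor completeness is required.  [metric i u] is the coefficient
   g_11 of the metric tensor in the chart i, at the coordinate u.  The map
   [chart_at] selects a chart around each point; a tangent vector at x is
   represented by its component in the chart [chart_at x], so T_xM is R. *)
Record riemannian1 (R : realType) (M : topologicalType) := Riemannian1 {
  r_hausdorff : hausdorff_space M ;
  r_second_countable : @second_countable M ;
  atlas : Type ;
  chart_of : atlas -> chart R M ;
  chart_at : M -> atlas ;
  chart_atP : forall x, cdom (chart_of (chart_at x)) x ;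
  metric : atlas -> R -> R ;
  transition_smooth : forall i j : atlas,
    smooth_on (cimg (chart_of i) `&` cinv (chart_of i) @^-1` cdom (chart_of j))
              (cmap (chart_of j) \o cinv (chart_of i)) ;
  metric_smooth : forall i, smooth_on (cimg (chart_of i)) (metric i) ;
  metric_gt0 : forall i u, cimg (chart_of i) u -> 0 < metric i u ;
  metric_transition : forall (i j : atlas) (u : R),
    cimg (chart_of i) u -> cdom (chart_of j) (cinv (chart_of i) u) ->
    metric i u = metric j (cmap (chart_of j) (cinv (chart_of i) u)) *
                 derive1 (cmap (chart_of j) \o cinv (chart_of i)) u ^+ 2
}.

Section riemannian_notions.
Variables (R : realType) (M : topologicalType) (G : riemannian1 R M).

Local Notation ch i := (chart_of (r := G) i).

Definition rinner (x : M) (v w : R) : R :=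
  metric (chart_at G x) (cmap (ch (chart_at G x)) x) * v * w.

Definition rnorm (x : M) (v : R) : R := Num.sqrt (rinner x v v).

Definition smooth_fun (phi : M -> R) : Prop :=
  forall i : atlas G, smooth_on (cimg (ch i)) (phi \o cinv (ch i)).

Definition test_function (phi : M -> R) : Prop :=
  smooth_fun phi /\ compact (closure [set x | phi x != 0]).

Definition grad (phi : M -> R) (x : M) : R :=
  let i := chart_at G x in
  let u := cmap (ch i) x in
  (metric i u)^-1 * derive1 (phi \o cinv (ch i)) u.

Definition velocity (c : R -> M) (t : R) : R :=
  derive1 (cmap (ch (chart_at G (c t))) \o c) t.

Definition C1_at (c : R -> M) (t : R) : Prop :=
  {for t, continuous c} /\
  forall i : atlas G, cdom (ch i) (c t) ->
    derivable (cmap (ch i) \o c) t 1 /\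
    {for t, continuous (derive1 (cmap (ch i) \o c))}.

(* C^1 curves parametrised by [0, 1], given with a C^1 extension to a
   neighbourhood of [0, 1], which exists because M has no boundary.  They need
   not be regular. *)
Definition C1_curve (c : R -> M) : Prop :=
  exists2 e : R, 0 < e & forall t, - e < t < 1 + e -> C1_at c t.

Definition curve_length (c : R -> M) : \bar R :=
  (\int[lebesgue_measure]_(t in `[0%R, 1%R]) (rnorm (c t) (velocity c t))%:E)%E.

(* +oo between different connected components *)
Definition rdist (x y : M) : \bar R :=
  ereal_inf [set curve_length c | c in
    [set c : R -> M | C1_curve c /\ c 0 = x /\ c 1 = y]].

Definition christoffel (i : atlas G) (u : R) : R :=
  derive1 (metric i) u / (2 * metric i u).

Definition geodesic_at (c : R -> M) (t : R) : Prop :=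
  {for t, continuous c} /\
  forall i : atlas G, cdom (ch i) (c t) ->
    let k := cmap (ch i) \o c in
    (\forall u \near t, derivable k u 1) /\ derivable (derive1 k) t 1 /\
    derive1n 2 k t + christoffel i (k t) * derive1 k t ^+ 2 = 0.

Definition geodesic01 (c : R -> M) : Prop :=
  exists2 e : R, 0 < e & forall t, - e < t < 1 + e -> geodesic_at c t.

(* The value is x when v lies outside the domain of the exponential map. *)
Definition rexp (x : M) (v : R) : M :=
  xget x [set y | exists c : R -> M,
    [/\ geodesic01 c, c 0 = x, velocity c 0 = v & c 1 = y]].

End riemannian_notions.


Definition nnreal (R : realType) : Type := {nonneg R}.

HB.instance Definition _ (R : realType) := Choice.on (nnreal R).
HB.instance Definition _ (R : realType) := isPointed.Build (nnreal R) 0%:nng.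

Definition nnval (R : realType) (r : nnreal R) : R := (r : {nonneg R})%:num.

(* [0, +oo) with its Borel sets *)
Definition halfline (R : realType) : Type :=
  g_sigma_algebra_preimageType (@nnval R).

HB.instance Definition _ (R : realType) := Measurable.on (halfline R).

Definition borel (M : ptopologicalType) : Type := g_sigma_algebraType (@open M).

HB.instance Definition _ (M : ptopologicalType) := Measurable.on (borel M).

Section cone_type.
Variables (R : realType) (M : ptopologicalType).

Definition cone_rel (p q : borel M * halfline R) : bool :=
  (p == q) || ((nnval p.2 == 0) && (nnval q.2 == 0)).

Lemma cone_rel_refl : reflexive cone_rel.
Proof. by move=> p; rewrite /cone_rel eqxx. Qed.

Lemma cone_rel_sym : symmetric cone_rel.
Proof. by move=> p q; rewrite /cone_rel eq_sym andbC. Qed.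

Lemma cone_rel_trans : transitive cone_rel.
Proof.
move=> q p r; rewrite /cone_rel => /orP[/eqP->//|/andP[p0 q0]].
by move=> /orP[/eqP<-|/andP[_ r0]]; apply/orP; right; apply/andP.
Qed.

Canonical cone_equiv := EquivRel cone_rel cone_rel_refl cone_rel_sym cone_rel_trans.

Definition cone : Type := {eq_quot cone_equiv}%qT.

HB.instance Definition _ := Choice.on cone.
HB.instance Definition _ := isPointed.Build cone (\pi_{eq_quot cone_equiv} point)%qT.

Definition cone_pt (p : borel M * halfline R) : cone :=
  (\pi_{eq_quot cone_equiv} p)%qT.

Definition cone_repr (p : cone) : borel M * halfline R :=
  repr (p : {eq_quot cone_equiv}%qT).

Lemma cone_reprK (p : cone) : cone_pt (cone_repr p) = p.
Proof. exact: reprK. Qed.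

Lemma cone_ptE (p q : borel M * halfline R) : (cone_pt p = cone_pt q) <-> cone_rel p q.
Proof. by split => [/eqquotP//|h]; apply/eqquotP. Qed.

Let cone_sigma_algebra :
  sigma_algebra [set: cone] (image_set_system setT cone_pt measurable).
Proof. exact/sigma_algebra_image/sigma_algebra_measurable. Qed.

Let cone_measurable0 : image_set_system setT cone_pt measurable set0.
Proof. by case: cone_sigma_algebra. Qed.

Let cone_measurableC A :
  image_set_system setT cone_pt measurable A ->
  image_set_system setT cone_pt measurable (~` A).
Proof. by case: cone_sigma_algebra => _ + _ mA => /(_ A mA); rewrite setTD. Qed.

Let cone_measurable_bigcup (F : (set cone)^nat) :
  (forall i, image_set_system setT cone_pt measurable (F i)) ->
  image_set_system setT cone_pt measurable (\bigcup_i F i).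
Proof. by case: cone_sigma_algebra => _ _; exact. Qed.

(* The quotient sigma-algebra.  When M is a second countable manifold, it is the
   Borel sigma-algebra of the cone metric. *)
HB.instance Definition _ := @isMeasurable.Build default_measure_display cone
  (image_set_system setT cone_pt measurable)
  cone_measurable0 cone_measurableC cone_measurable_bigcup.

Lemma measurable_cone_pt : measurable_fun [set: borel M * halfline R] cone_pt.
Proof. by move=> _ A; rewrite /measurable. Qed.

End cone_type.

Section curvature.
Variables (R : realType) (M : ptopologicalType) (G : riemannian1 R M).

(* The formula does not depend on the representatives, by [cone_distE]. *)
Definition cone_dist (p q : cone R M) : R :=
  let: (x, r) := cone_repr p in
  let: (y, r') := cone_repr q in
  Num.sqrt (nnval r ^+ 2 + nnval r' ^+ 2 -
    2 * nnval r * nnval r' * cos (fine (mine (rdist G x y) (pi%:E)))).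

Lemma cone_distE (x y : M) (r r' : halfline R) :
  cone_dist (cone_pt (x, r)) (cone_pt (y, r')) =
  Num.sqrt (nnval r ^+ 2 + nnval r' ^+ 2 -
    2 * nnval r * nnval r' * cos (fine (mine (rdist G x y) (pi%:E)))).
Proof.
rewrite /cone_dist.
have : cone_rel (cone_repr (cone_pt (x, r))) (x, r).
  by apply/cone_ptE; rewrite cone_reprK.
have : cone_rel (cone_repr (cone_pt (y, r'))) (y, r').
  by apply/cone_ptE; rewrite cone_reprK.
case: (cone_repr _) => y1 r1; case: (cone_repr _) => x1 r2.
rewrite /cone_rel /= => /orP[/eqP[-> ->]|/andP[/eqP-> /eqP->]];
  move=> /orP[/eqP[-> ->]|/andP[/eqP-> /eqP->]] //;
  by rewrite ?(mulr0, mul0r).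
Qed.

(* (v, s) is a tangent vector at the point (x, r) of the cone, r > 0.  Only the
   values on the domain s > - r, |v| < (1 + s / r) pi / 2 are meaningful. *)
Definition cone_exp (p : cone R M) (w : R * R) : cone R M :=
  let: (x, r) := cone_repr p in
  let: (v, s) := w in
  let n := rnorm G x v in
  cone_pt (if v == 0 then x
           else rexp G x (atan (nnval r * n / (nnval r + s)) * (v / n)),
           (Num.sqrt ((nnval r + s) ^+ 2 + nnval r ^+ 2 * n ^+ 2))%:nng).

Definition cone_grad (phi : M -> R) (p : cone R M) : R * R :=
  let: (x, r) := cone_repr p in (grad G phi x, 2 * nnval r * phi x).

Variable mu : {finite_measure set (borel M) -> \bar R}.

Definition H1_normsq (phi : M -> R) : R :=
  \int[mu]_(x in [set: borel M])
    (rnorm G x (grad G phi x) ^+ 2 + 4 * phi x ^+ 2).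

Definition H1_inner (phi psi : M -> R) : R :=
  \int[mu]_(x in [set: borel M])
    (rinner G x (grad G phi x) (grad G psi x) + 4 * (phi x * psi x)).

Definition Lambda (phi psi : M -> R) : R :=
  H1_normsq phi * H1_normsq psi - H1_inner phi psi ^+ 2.

Definition mass_radius : {nonneg R} := (Num.sqrt (fine (mu setT)))%:nng.

Definition lift_mu : set (cone R M) -> \bar R :=
  pushforward (mu \x \d_(mass_radius : halfline R))%E (@cone_pt R M).

Let lift_mu0 : lift_mu set0 = 0%E.
Proof. exact: measure0. Qed.

Let lift_mu_ge0 A : (0 <= lift_mu A)%E.
Proof. exact: measure_ge0. Qed.

Let lift_mu_sigma_additive : semi_sigma_additive lift_mu.
Proof. by apply: measure_semi_sigma_additive; exact: measurable_cone_pt. Qed.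

HB.instance Definition _ := isMeasure.Build _ _ _ lift_mu
  lift_mu0 lift_mu_ge0 lift_mu_sigma_additive.

Definition hat_mu := mscale (mass_radius%:num ^- 2)%:nng lift_mu.

HB.instance Definition _ := Measure.on hat_mu.

Definition sec_up_quotient (phi psi : M -> R) (s t : R) : R :=
  3 / (Lambda phi psi * s ^+ 2 * t ^+ 2) *
  (H1_normsq (fun x => s * phi x - t * psi x) -
   \int[hat_mu]_(p in [set: cone R M])
     cone_dist (cone_exp p (s *: (cone_grad phi p : R^o * R^o)))
               (cone_exp p (t *: (cone_grad psi p : R^o * R^o))) ^+ 2).

End curvature.

Definition lim_star (R : realType) (F : R -> R -> R) (L : R) : Prop :=
  forall s t : nat -> R,
    (forall j, 0 < s j) -> (forall j, 0 < t j) ->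
    s @ \oo --> (0 : R) -> t @ \oo --> (0 : R) ->
    (exists K : R, forall j, s j / t j + t j / s j <= K) ->
    (fun j => F (s j) (t j)) @ \oo --> L.

(* Sec = L means that the limit defining it exists and is L. *)
Definition is_Sec_up (R : realType) (M : ptopologicalType) (G : riemannian1 R M)
    (mu : {finite_measure set (borel M) -> \bar R}) (phi psi : M -> R) (L : R) :=
  lim_star (sec_up_quotient G mu phi psi) L.

(* Main.v *)
Require Import Defs.
From HB Require Import structures.
From mathcomp Require Import all_boot all_order all_algebra.
From mathcomp Require Import ring lra.
From mathcomp Require Import all_classical all_reals all_analysis.
From mathcomp Require Import measurable_realfun.

Import Order.TTheory GRing.Theory Num.Theory.
Import numFieldNormedType.Exports.

Local Open Scope classical_set_scope.
Local Open Scope ring_scope.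

(** In dimension 1 the manifold [M] is locally isometric to the line, so the cone
    over [M] is locally isometric, away from its apex, to the Euclidean plane in
    polar coordinates.  The quantity whose limit defines the lifted curvature is
    therefore not only small: it is exactly 0 as soon as [s] and [t] are small
    enough.

    Integrating the square root of the metric coefficient gives around every point
    an arclength chart [(W, sigma, gamma)] ([arc_chart_exists]), in which the
    geodesic equation reads [(sigma \o c)'' = 0].  Hence for small [v] the
    exponential map adds to [sigma x] the component of [v] along the unit field
    ([rexp_arc]), and the Riemannian distance of two nearby points is the distance
    of their coordinates ([rdist_arc]).  The lower bound there has to deal with the
    curves that leave [W]: their length is at least the variation of a C^1
    truncation of [sigma], which is defined on the whole of [M].

    If [nu] is the component of [s grad phi] along the unit field and
    [m = 1 + 2 s phi], the exponential of [s (grad phi, 2 r phi)] at [(x, r)] is the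
    point with polar coordinates [rho = r sqrt (m^2 + nu^2)] and
    [alpha = sigma x + arctan (nu / m)], that is the point [(r m, r nu)] of the plane,
    up to a rotation.  The difference of two angles being less than pi, the law of
    cosines gives for the two exponentials
      [d_C^2 = r^2 (|s grad phi - t grad psi|^2 + 4 (s phi - t psi)^2)]
    ([cone_dist_arc]).  By compactness of the supports this holds for all [x]
    simultaneously when [(s, t)] is close to [(0, 0)] ([near0_cone_flat]), and
    integrating it against the lift of [mu] ([Rintegral_hat_mu]) gives the squared
    [H^1(mu)] norm of [s phi - t psi]. *)

Set Implicit Arguments.
Unset Strict Implicit.
Unset Printing Implicit Defensive.

(** * Functions of one real variable *)

Lemma derivable_is_derive (R : realType) (f : R -> R) (x : R) :
  derivable f x 1 -> is_derive x 1 f (derive1 f x).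
Proof. by move=> fx; rewrite derive1E; exact: derivableP. Qed.

Lemma is_derive_derive1 (R : realType) (f : R -> R) (x d : R) :
  is_derive x 1 f d -> derive1 f x = d.
Proof. by move=> fx; rewrite derive1E derive_val. Qed.

Lemma derivable_continuous (R : realType) (f : R -> R) (x : R) :
  derivable f x 1 -> {for x, continuous f}.
Proof. by move=> /derivable1_diffP/differentiable_continuous. Qed.

Lemma near_ballP (R : realType) (x : R) (P : R -> Prop) :
  (\forall y \near x, P y) ->
  exists2 e : R, 0 < e & forall y, `|y - x| < e -> P y.
Proof.
by move=> /nbhs_ballP[e e0 H]; exists e => // y yx; apply: H; rewrite /ball/= distrC.
Qed.

Lemma ball_near (R : realType) (x e : R) (P : R -> Prop) :
  0 < e -> (forall y, `|y - x| < e -> P y) -> \forall y \near x, P y.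
Proof.
by move=> e0 H; apply/nbhs_ballP; exists e => // y yx; apply: H; rewrite distrC.
Qed.

Lemma near_preimage (T U : topologicalType) (f : T -> U) (x : T) (A : set U) :
  {for x, continuous f} -> open A -> A (f x) -> \forall y \near x, A (f y).
Proof. by move=> cf oA Afx; apply: cf; exact: open_nbhs_nbhs. Qed.

Lemma near_norm_lt (R : realType) (s L : R) :
  `|s| < L -> \forall r \near s, `|r| < L.
Proof.
move=> sL; apply: (@near_preimage R R (fun y : R => `|y|) s [set y | y < L]) => //.
exact: norm_continuous.
Qed.

Lemma is_derive_derivable (R : realType) (f : R -> R) (x d : R) :
  is_derive x 1 f d -> derivable f x 1.
Proof. by case. Qed.

Lemma near_oo (R : realType) (a b t : R) :
  a < t < b -> \forall u \near t, a < u < b.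
Proof.
move=> tab; have oab : open `]a, b[%classic by exact: interval_open.
have /(conj oab)/open_nbhs_nbhs : `]a, b[%classic t by rewrite /= in_itv.
by apply: filterS => u /=; rewrite in_itv.
Qed.

Lemma near_eq_continuous (T U : topologicalType) (f g : T -> U) (x : T) :
  (\forall y \near x, f y = g y) -> {for x, continuous f} -> {for x, continuous g}.
Proof.
move=> fg cf; have fgx : f x = g x := nbhs_singleton fg.
by move: cf; rewrite /prop_for /continuous_at fgx; apply: cvg_trans; exact: near_eq_cvg.
Qed.

Lemma continuous_within (R : realType) (a b : R) (f : R -> R) :
  (forall x, a <= x <= b -> {for x, continuous f}) -> {within `[a, b], continuous f}.
Proof.
move=> cf; apply: continuous_in_subspaceT => x /set_mem/=.
by rewrite in_itv/=; exact: cf.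
Qed.

Lemma is_derive_cst_ball (R : realType) (f : R -> R) (x e : R) :
  (forall y, `|y - x| < e -> is_derive y 1 f 0) ->
  forall y, `|y - x| < e -> f y = f x.
Proof.
move=> df y; rewrite ltr_norml => /andP[yx1 yx2].
have cst a b : x - e < a -> b < x + e -> a <= b -> f b = f a.
  move=> xa bx ab.
  have [z /[!in_itv]/= /andP[az zb]||c _] := @MVT_segment _ f (fun=> 0) _ _ ab.
  - by apply: df; rewrite ltr_norml; lra.
  - apply: continuous_within => z /andP[az zb]; apply: derivable_continuous.
    have dz : is_derive z 1 f 0 by apply: df; rewrite ltr_norml; lra.
    exact: ex_derive.
  - by rewrite mul0r => /subr0_eq.
by have [xy|/ltW yx] := leP x y; [|apply/esym]; apply: cst; lra.
Qed.

(** A function whose second derivative vanishes is locally affine. *)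
Lemma near_affine (R : realType) (h : R -> R) (x : R) :
  (\forall y \near x, derivable h y 1 /\ is_derive y 1 (derive1 h) 0) ->
  \forall y \near x, h y = h x + derive1 h x * (y - x) /\ derive1 h y = derive1 h x.
Proof.
move=> /near_ballP[e e0 H]; apply: (ball_near e0).
have h'E : forall y, `|y - x| < e -> derive1 h y = derive1 h x.
  by apply: is_derive_cst_ball => y /H[].
move=> y yx; split; last exact: h'E.
pose k z := h z - derive1 h x * (z - x).
have : k y = k x.
  apply: (@is_derive_cst_ball _ _ _ e) => // z zx.
  have hz := derivable_is_derive (H z zx).1.
  have : is_derive z 1 k (derive1 h z - derive1 h x *: (1 - 0)).
    by rewrite /k; exact: is_deriveB.
  by rewrite h'E// subr0 /GRing.scale/= mulr1 subrr.
rewrite /k subrr mulr0 subr0 => <-; lra.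
Qed.

Lemma primitive_oo (R : realType) (f : R -> R) (a b : R) :
  (forall x, a <= x <= b -> {for x, continuous f}) ->
  exists F : R -> R, forall x, a < x < b -> is_derive x 1 F (f x).
Proof.
move=> cf.
exists (fun x => (\int[lebesgue_measure]_(t in [set` Interval (BLeft a) (BRight x)]) (f t))%R).
move=> x /andP[ax xb].
have fi : lebesgue_measure.-integrable
    [set` Interval (BLeft a) (BRight b)] (EFin \o f).
  apply: continuous_compact_integrable; first exact: segment_compact.
  exact: continuous_within.
have fx : {for x, continuous f} by apply: cf; rewrite !ltW.
have [dF <-] := continuous_FTC1 xb fi ax fx.
exact: derivable_is_derive.
Qed.

(** The arclength coordinate [S] of the line element [f(u) du] near [u0], with
    its inverse [Si]. *)
Lemma arclength_coordinate (R : realType) (U : set R) (f : R -> R) (u0 : R) :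
  open U -> U u0 -> (forall u, U u -> {for u, continuous f}) ->
  (forall u, U u -> 0 < f u) ->
  exists (I : set R) (S Si : R -> R) (L : R),
    [/\ open I, I `<=` U, I u0, 0 < L & S u0 = 0] /\
    (forall u, I u -> is_derive u 1 S (f u) /\ Si (S u) = u) /\
    (forall s, `|s| < L -> [/\ I (Si s), S (Si s) = s &
                               is_derive s 1 Si (f (Si s))^-1]).
Proof.
move=> oU Uu0 cf f0.
have /near_ballP[e e0 He] : \forall u \near u0, U u by exact: open_nbhs_nbhs.
pose a := u0 - e / 2; pose b := u0 + e / 2.
have au0 : a < u0 by rewrite /a; lra.
have u0b : u0 < b by rewrite /b; lra.
have abU u : a <= u <= b -> U u.
  by rewrite /a /b => /andP[au ub]; apply: He; rewrite ltr_norml; lra.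
have [F HF] : exists F : R -> R, forall x, a < x < b -> is_derive x 1 F (f x).
  by apply: primitive_oo => x /abU; exact: cf.
pose I := [set u : R | a < u < b].
have IE : I = `]a, b[%classic by apply/seteqP; split => u /=; rewrite in_itv.
have oI : open I by rewrite IE; exact: interval_open.
have IU : I `<=` U by move=> u /andP[au ub]; apply: abU; rewrite !ltW.
have Iu0 : I u0 by rewrite /I/= au0.
pose S u := F u - F u0.
have dS u : I u -> is_derive u 1 S (f u).
  by move=> /HF dF; rewrite -[f u]subr0 /S; apply: is_deriveB.
have S_cont u : I u -> {for u, continuous S}.
  by move=> /dS[dSu _]; exact: derivable_continuous.
have S_lt u v : I u -> I v -> u < v -> S u < S v.
  move=> /andP[au ub] /andP[av vb] uv; rewrite -subr_gt0.
  have [||w wuv ->] := @MVT _ S f _ _ uv.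
  - move=> x; rewrite in_itv/= => /andP[ux xv]; apply: dS.
    by rewrite /I/= (lt_trans au ux) (lt_trans xv vb).
  - apply: continuous_within => x /andP[ux xv]; apply: S_cont.
    by rewrite /I/= (lt_le_trans au ux) (le_lt_trans xv vb).
  move: wuv; rewrite in_itv/= => /andP[uw wv].
  rewrite mulr_gt0 ?subr_gt0//; apply/f0/IU.
  by rewrite /I/= (lt_trans au uw) (lt_trans wv vb).
have S_inj u v : I u -> I v -> S u = S v -> u = v.
  move=> Iu Iv; have [uv|vu|//] := ltgtP u v.
    by have := S_lt _ _ Iu Iv uv; lra.
  by have := S_lt _ _ Iv Iu vu; lra.
(* The inverse is only used on the image of the smaller interval ]a', b'[. *)
pose a' := u0 - e / 4; pose b' := u0 + e / 4.
have Ia' : I a' by rewrite /I/= /a /b /a'; lra.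
have Ib' : I b' by rewrite /I/= /a /b /b'; lra.
have Su0 : S u0 = 0 by rewrite /S subrr.
have Sa' : S a' < 0 by rewrite -Su0; apply: S_lt => //; rewrite /a'; lra.
have Sb' : 0 < S b' by rewrite -Su0; apply: S_lt => //; rewrite /b'; lra.
pose L := Num.min (- S a') (S b').
have L0 : 0 < L by rewrite /L lt_min; lra.
pose Si s := xget u0 [set u | I u /\ S u = s].
have SiS u : I u -> Si (S u) = u.
  by move=> Iu; apply: xget_unique => // v [Iv /S_inj]; exact.
have SSi s : `|s| < L -> I (Si s) /\ S (Si s) = s.
  rewrite /L lt_min => /andP[]; rewrite !ltr_norml => /andP[s1 s2] /andP[s3 s4].
  have a'b' : a' <= b' by rewrite /a' /b'; lra.
  have cS : {within `[a', b'], continuous S}.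
    apply: continuous_within => x /andP[xa xb]; apply: S_cont.
    by move: Ia' Ib' => /andP[? ?] /andP[? ?]; rewrite /I/=; lra.
  have [||u /=] := @segment_continuous_le_surjective _ a' b' S a'b' _ cS s.
  - lra.
  - by rewrite /= in_itv/=; lra.
  rewrite in_itv/= => /andP[ua ub] Sus.
  apply: (@xgetPex _ u0 [set u | I u /\ S u = s]); exists u; split => //.
  by move: Ia' Ib' => /andP[? ?] /andP[? ?]; rewrite /I/=; lra.
exists I, S, Si, L; split; first by split.
split; first by move=> u Iu; split; [exact: dS|exact: SiS].
move=> s sL; have [ISi SSis] := SSi s sL; split => //.
have nI : \forall u \near Si s, I u by exact: open_nbhs_nbhs.
rewrite -[X in is_derive X]SSis; apply: is_derive_inverse.
- by apply: filterS nI => u; exact: SiS.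
- by apply: filterS nI => u; exact: S_cont.
- exact: dS.
- by rewrite gt_eqF//; apply/f0/IU.
Qed.

Lemma is_derive_sqr_pos (R : realType) (x : R) :
  is_derive x 1 (fun y : R => Num.max y 0 ^+ 2) (2 * Num.max x 0).
Proof.
have [x0|x0|->] := ltgtP x 0.
- have -> : 2 * 0 = 0 :> R by rewrite mulr0.
  apply: (@near_eq_is_derive _ _ _ (fun=> 0)).
  near=> y; rewrite max_r ?expr0n//; near: y.
  by apply: (@ball_near _ _ (- x)) => [|y]; [lra|rewrite ltr_norml; lra].
- apply: (@near_eq_is_derive R R R (fun y : R => y ^+ 2)).
    near=> y; rewrite max_l//; near: y.
    by apply: (@ball_near _ _ x) => [//|y]; rewrite ltr_norml; lra.
  have := @is_deriveM R R id id x 1 1 1 (is_derive_id _ _) (is_derive_id _ _).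
  by rewrite /GRing.scale/= mulr1 mulr_natl mulr2n.
- rewrite mulr0; apply/is_derive1_caratheodory.
  exists (fun y => Num.max y 0); split.
  + move=> y; rewrite subr0 maxxx expr0n/= subr0.
    by have [y0|y0] := leP y 0; rewrite ?expr0n ?mul0r// expr2.
  + by apply: continuous_max; [exact: cvg_id|exact: cvg_cst].
  + by rewrite maxxx.
Unshelve. all: by end_near. Qed.

(** A truncation of the identity: equal to the identity on [-e, e], supported in
    [-5e, 5e], and with slope in [-1, 1].  On the half-line [s >= 0] the slope is
    piecewise affine with values 1, 1, -1, 0 at the nodes 0, e, 3e, 5e. *)
Lemma cutoff_id (R : realType) (e : R) : 0 < e ->
  exists chi w : R -> R,
    [/\ forall s : R, is_derive s 1 chi (w s), continuous w,
        forall s, `|w s| <= 1, forall s, `|s| <= e -> chi s = s &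
        forall s, 5 * e <= `|s| -> chi s = 0].
Proof.
move=> e0.
pose m (a y : R) : R := Num.max (y - a) 0.
have dm (a y : R) : is_derive y 1 (fun z : R => m a z ^+ 2) (2 * m a y).
  rewrite -[2 * _]mulr1.
  apply: (@is_derive1_comp _ (fun z : R => Num.max z 0 ^+ 2) (fun z : R => z - a)).
    exact: is_derive_sqr_pos.
  by rewrite -[X in is_derive _ _ _ X]subr0; exact: is_deriveB.
have cm a : continuous (m a).
  move=> y; apply: (@continuous_max _ _ (fun z : R => z - a) (fun=> 0));
    last exact: cvg_cst.
  by apply: continuousB; [exact: cvg_id|exact: cvg_cst].
(* The second derivative of the truncation jumps by -1/e, 3/(2e) and -1/(2e) at
   e, 3e and 5e; B collects the corresponding truncated squares, up to the sign. *)
pose B s := e^-1 * (2^-1 * m e s ^+ 2 + (- (3 / 4)) * m (3 * e) s ^+ 2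
  + 4^-1 * m (5 * e) s ^+ 2).
pose B' s := e^-1 * (m e s + (- (3 / 2)) * m (3 * e) s + 2^-1 * m (5 * e) s).
have dB (y : R) : is_derive y 1 B (B' y).
  have -> : B' y = e^-1 *: (2^-1 *: (2 * m e y) + (- (3 / 4)) *: (2 * m (3 * e) y)
      + 4^-1 *: (2 * m (5 * e) y)).
    by rewrite /B' /GRing.scale/=; field; rewrite gt_eqF.
  exact: is_deriveZ.
have cB' : continuous B'.
  move=> y; rewrite /B'; apply: cvgM; first exact: cvg_cst.
  apply: cvgD; [apply: cvgD|]; [exact: cm| |];
    by apply: cvgM; [exact: cvg_cst|exact: cm].
have B'ge0 y : 0 <= B' y <= 2.
  have H : 0 <= m e y + - (3 / 2) * m (3 * e) y + 2^-1 * m (5 * e) y <= 2 * e.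
    by rewrite /m/=; have [?|?] := leP (y - e) 0; have [?|?] := leP (y - 3 * e) 0;
      have [?|?] := leP (y - 5 * e) 0; lra.
  rewrite /B'; apply/andP; split; first by apply: mulr_ge0; [rewrite invr_ge0 ltW|lra].
  by rewrite mulrC ler_pdivrMr//; lra.
have B0 y : y <= e -> B y = 0 /\ B' y = 0.
  move=> ye; have m0 a : e <= a -> m a y = 0 by move=> ea; rewrite /m max_r//; lra.
  by rewrite /B /B' !m0; try lra; split; ring.
have B5 y : 5 * e <= y -> B y = y.
  move=> ye; rewrite /B /m !max_l; try lra.
  by field; rewrite gt_eqF.
exists (fun s => s - B s + B (- s)), (fun s => 1 - B' s + B' (- s) * (- 1)); split.
- move=> s; have H1 : is_derive s 1 (fun s : R => s - B s) (1 - B' s) by exact: is_deriveB.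
  have H2 : is_derive s 1 (B \o -%R) (B' (- s) * (- 1)) by exact: is_derive1_comp.
  exact: (@is_deriveD _ _ _ _ _ _ _ _ _ H1 H2).
- move=> y; apply: cvgD; first by apply: cvgB; [exact: cvg_cst|exact: cB'].
  apply: cvgM; last exact: cvg_cst.
  apply: (@continuous_comp _ _ _ -%R B'); last exact: cB'.
  exact: opp_continuous.
- move=> s; rewrite ler_norml.
  have [s0|s0] := leP s 0.
    have [_ ->] := B0 s ltac:(lra); have := B'ge0 (- s); lra.
  have [_ ->] := B0 (- s) ltac:(lra); have := B'ge0 s; lra.
- move=> s; rewrite ler_norml => /andP[s1 s2].
  by have [-> _] := B0 s s2; have [-> _] := B0 (- s) ltac:(lra); ring.
- move=> s; have [s0|s0] := ger0P s => es.
    by have [-> _] := B0 (- s) ltac:(lra); rewrite (B5 s es); ring.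
  by have [-> _] := B0 s ltac:(lra); rewrite (B5 (- s) es); ring.
Qed.

(** The length estimate: the variation of a function is at most the integral of a
    bound of its derivative. *)
Lemma variation_le_integral (R : realType) (F f g : R -> R) :
  (forall t : R, 0 <= t <= 1 -> is_derive t 1 F (f t)) ->
  (forall t : R, 0 <= t <= 1 -> {for t, continuous f}) ->
  (forall t : R, 0 <= t <= 1 -> {for t, continuous g}) ->
  (forall t : R, 0 <= t <= 1 -> `|f t| <= g t) ->
  ((`|F 1 - F 0|)%:E <= \int[lebesgue_measure]_(t in `[0%R, 1%R]) (g t)%:E)%E.
Proof.
move=> dF cf cg fg.
have cF t : 0 <= t <= 1 -> {for t, continuous F}.
  by move=> /dF[? _]; exact: derivable_continuous.
have cfW := continuous_within cf.
have fi : lebesgue_measure.-integrable `[0%R, 1%R] (EFin \o f).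
  by apply: continuous_compact_integrable cfW; exact: segment_compact.
have gi : lebesgue_measure.-integrable `[0%R, 1%R] (EFin \o g).
  apply: continuous_compact_integrable (continuous_within cg).
  exact: segment_compact.
have FTC : (\int[lebesgue_measure]_(t in `[0%R, 1%R]) (f t)%:E = (F 1)%:E - (F 0)%:E)%E.
  apply: continuous_FTC2 => //.
  - split.
    + by move=> t /[!in_itv]/= /andP[t0 t1]; have [] := dF t; rewrite ?ltW.
    + by apply: cvg_at_right_filter; apply: cF; rewrite lexx ler01.
    + by apply: cvg_at_left_filter; apply: cF; rewrite lexx ler01.
  - move=> t /[!in_itv]/= /andP[t0 t1]; apply: is_derive_derive1.
    by apply: dF; rewrite !ltW.
have -> : (`|F 1 - F 0|%:E = `|\int[lebesgue_measure]_(t in `[0%R, 1%R]) (f t)%:E|)%E.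
  by rewrite FTC.
apply: le_trans (le_abse_integral _ _ _) _ => //.
  by case/integrableP: fi.
apply: ge0_le_integral => //.
- by case/integrableP: fi => mf _; exact: (measurableT_comp (@abse_measurable R setT) mf).
- by case/integrableP: gi.
Qed.

(** * Arclength charts *)

(** An arclength coordinate on an open set [W]: [sigma] maps [W] homeomorphically
    onto ]-L, L[, with inverse [gamma], and has unit speed for the metric in every
    chart.  Since [M] has dimension 1 this is a local isometry with the line. *)
Record arc_chart (R : realType) (M : topologicalType) (G : riemannian1 R M)
    (L : R) (W : set M) (sigma : M -> R) (gamma : R -> M) : Prop := ArcChart {
  arc_gt0 : 0 < L ;
  arc_open : open W ;
  arc_gammaK : forall x, W x -> `|sigma x| < L /\ gamma (sigma x) = x ;
  arc_sigmaK : forall s, `|s| < L ->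
    [/\ W (gamma s), sigma (gamma s) = s & {for s, continuous gamma}] ;
  arc_gamma_unit : forall (j : atlas G) s, `|s| < L -> cdom (chart_of j) (gamma s) ->
    let T := cmap (chart_of j) \o gamma in
    [/\ derivable T s 1, derivable (derive1 T) s 1 &
        metric j (T s) * derive1 T s ^+ 2 = 1] ;
  arc_sigma_unit : forall (j : atlas G) u, cimg (chart_of j) u ->
    W (cinv (chart_of j) u) ->
    let D := sigma \o cinv (chart_of j) in
    [/\ derivable D u 1, derivable (derive1 D) u 1 & derive1 D u ^+ 2 = metric j u]
}.

Section riemannian_line.
Variables (R : realType) (M : topologicalType) (G : riemannian1 R M).
Local Notation ch i := (chart_of (r := G) i).

Lemma transition_derivable (i j : atlas G) (u : R) :
  cimg (ch i) u -> cdom (ch j) (cinv (ch i) u) ->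
  derivable (cmap (ch j) \o cinv (ch i)) u 1 /\
  derivable (derive1 (cmap (ch j) \o cinv (ch i))) u 1.
Proof.
move=> iu ju; have H := @transition_smooth _ _ G i j.
by split; [exact: (H 0%N u (conj iu ju))|exact: (H 1%N u (conj iu ju))].
Qed.

Lemma metric_derivable (i : atlas G) (u : R) :
  cimg (ch i) u -> derivable (metric i) u 1.
Proof. by move=> iu; exact: (@metric_smooth _ _ G i 0%N u iu). Qed.

Lemma sqrt_metric_derive (i : atlas G) (u : R) : cimg (ch i) u ->
  derivable (fun v => Num.sqrt (metric i v)) u 1.
Proof.
move=> iu.
have dm := derivable_is_derive (metric_derivable iu).
have ds := @is_derive1_sqrt R (metric i u) (metric_gt0 iu).
exact: (is_derive_derivable (@is_derive1_comp _ _ _ _ _ _ ds dm)).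
Qed.

Lemma near_cdom (c : R -> M) (t : R) (i : atlas G) :
  {for t, continuous c} -> cdom (ch i) (c t) -> \forall u \near t, cdom (ch i) (c u).
Proof. by move=> ct it; apply: near_preimage => //; exact: cdom_open. Qed.

Lemma arc_chart_exists (p : M) : exists L W sigma gamma,
  [/\ arc_chart G L W sigma gamma, W p & sigma p = 0].
Proof.
pose i := chart_at G p; pose f (u : R) : R := Num.sqrt (metric i u).
have ip : cdom (ch i) p := chart_atP G p.
have f_gt0 u : cimg (ch i) u -> 0 < f u by move=> iu; rewrite sqrtr_gt0 metric_gt0.
have df u : cimg (ch i) u -> derivable f u 1 by exact: sqrt_metric_derive.
have [I [S [Si [L [[oI IU Iu0 L0 S0] [HS HSi]]]]]] :=
  arclength_coordinate (@cimg_open _ _ (ch i)) (cmap_img ip)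
    (fun u iu => derivable_continuous (df u iu)) f_gt0.
have S_cont u : I u -> {for u, continuous S}.
  by move=> /HS[/is_derive_derivable/derivable_continuous].
pose sigma := S \o cmap (ch i); pose gamma := cinv (ch i) \o Si.
pose W := [set x | [/\ cdom (ch i) x, I (cmap (ch i) x) & `|sigma x| < L]].
have gamma_cont s : `|s| < L -> {for s, continuous gamma}.
  move=> /HSi[ISi _ dSi]; apply: continuous_comp.
    exact/derivable_continuous/is_derive_derivable.
  by apply: cinv_continuous; exact: IU.
have oW : open W.
  rewrite openE => x [ix Ix Lx].
  have cx : {for x, continuous (cmap (ch i))} by exact: cmap_continuous.
  have n1 : \forall y \near x, cdom (ch i) y.
    by apply: open_nbhs_nbhs; split => //; exact: cdom_open.
  have n2 : \forall y \near x, I (cmap (ch i) y) by exact: near_preimage.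
  have n3 : \forall y \near x, `|sigma y| < L.
    have cs : {for x, continuous sigma} by apply: continuous_comp => //; exact: S_cont.
    exact: (cs _ (near_norm_lt Lx)).
  by rewrite /interior; near=> y; split; near: y.
exists L, W, sigma, gamma; split; last 2 first.
- by split => //; rewrite /sigma/= S0 normr0.
- by rewrite /sigma/= S0.
split => //.
- by move=> x [ix Ix Lx]; split => //; rewrite /gamma/= (HS _ Ix).2 cmapK.
- move=> s sL; have [ISi SSi _] := HSi s sL; have iSi := IU _ ISi.
  split; [split| |exact: gamma_cont]; rewrite /gamma/sigma/= ?cinvK//.
  + exact: cinv_dom.
  + by rewrite SSi.
- move=> j s sL js T.
  pose tau := cmap (ch j) \o cinv (ch i).
  have dT r : `|r| < L -> cdom (ch j) (gamma r) ->
      is_derive r 1 T (derive1 tau (Si r) * (f (Si r))^-1).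
    move=> rL jr; have [ISi _ dSi] := HSi r rL.
    have [dtau _] := transition_derivable (IU _ ISi) jr.
    exact: (@is_derive1_comp _ tau Si _ _ _ (derivable_is_derive dtau) dSi).
  have [ISi SSi dSi] := HSi s sL; have iSi := IU _ ISi.
  split; first exact: is_derive_derivable (dT s sL js).
  + have : derivable (fun r => derive1 tau (Si r) * (f (Si r))^-1) s 1.
      have [_ ddtau] := transition_derivable iSi js.
      have d1 := is_derive1_comp (derivable_is_derive ddtau) dSi.
      have d2 := is_derive1_comp (derivable_is_derive (df _ iSi)) dSi.
      apply: (@derivableM _ _ (derive1 tau \o Si) (fun r => (f (Si r))^-1)).
        exact: is_derive_derivable d1.
      apply: (@derivableV _ _ (f \o Si)); last exact: is_derive_derivable d2.
      by rewrite gt_eqF//; exact: f_gt0.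
    apply: near_eq_derivable.
    have n1 := near_norm_lt sL.
    have n2 := near_cdom (gamma_cont s sL) js.
    near=> r; apply/esym/is_derive_derive1/dT; by near: r.
  + rewrite (is_derive_derive1 (dT s sL js)) exprMn exprVn mulrA.
    have /= := metric_transition iSi js; rewrite -/tau => E.
    rewrite /T/= -[X in X / _]E /f sqr_sqrtr ?ltW ?metric_gt0//.
    by rewrite mulfV// gt_eqF// metric_gt0.
- move=> j u ju Wu D.
  pose tau := cmap (ch i) \o cinv (ch j).
  have dD v : cimg (ch j) v -> W (cinv (ch j) v) ->
      is_derive v 1 D (f (tau v) * derive1 tau v).
    move=> jv [iv Iv Lv].
    have [dtau _] := transition_derivable jv iv.
    exact: (@is_derive1_comp _ S tau _ _ _ (HS _ Iv).1 (derivable_is_derive dtau)).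
  have [iu Iu Lu] := Wu.
  have [dtau ddtau] := transition_derivable ju iu.
  split; first exact: is_derive_derivable (dD u ju Wu).
  + have : derivable (fun v => f (tau v) * derive1 tau v) u 1.
      apply: (@derivableM _ _ (f \o tau) (derive1 tau)) => //.
      apply: is_derive_derivable.
      exact: (is_derive1_comp (derivable_is_derive (df _ (IU _ Iu))) (derivable_is_derive dtau)).
    apply: near_eq_derivable.
    have n1 : \forall v \near u, cimg (ch j) v.
      by apply: open_nbhs_nbhs; split => //; exact: cimg_open.
    have n2 : \forall v \near u, W (cinv (ch j) v).
      by apply: near_preimage => //; exact: cinv_continuous.
    near=> v; apply/esym/is_derive_derive1/dD; by near: v.
  + rewrite (is_derive_derive1 (dD u ju Wu)) exprMn (metric_transition ju iu).
    by rewrite /f sqr_sqrtr// ltW// metric_gt0//; exact: cmap_img.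
Unshelve. all: by end_near. Qed.

End riemannian_line.

Section arc_chart_theory.
Variables (R : realType) (M : topologicalType) (G : riemannian1 R M).
Local Notation ch i := (chart_of (r := G) i).
Variables (L : R) (W : set M) (sigma : M -> R) (gamma : R -> M).
Hypothesis hW : arc_chart G L W sigma gamma.

(** The derivative of the arclength coordinate at [x], on the components of tangent
    vectors in the preferred chart at [x]. *)
Definition darc (x : M) : R :=
  let j := chart_at G x in derive1 (sigma \o cinv (ch j)) (cmap (ch j) x).

(** Equivalently, [darc] is a square root of the metric coefficient; its sign records
    the relative orientation of the two charts. *)
Lemma rinner_arc (x : M) (v w : R) : W x ->
  rinner G x v w = (darc x * v) * (darc x * w).
Proof.
move=> Wx; rewrite /rinner /darc; set j := chart_at G x.
have jx : cdom (ch j) x := chart_atP G x.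
have Wx' : W (cinv (ch j) (cmap (ch j) x)) by rewrite cmapK.
have [_ _ <-] := arc_sigma_unit hW (cmap_img jx) Wx'.
by ring.
Qed.

Lemma rnorm_arc (x : M) (v : R) : W x -> rnorm G x v = `|darc x * v|.
Proof. by move=> Wx; rewrite /rnorm rinner_arc// -expr2 sqrtr_sqr. Qed.

Lemma near_W (c : R -> M) (t : R) :
  {for t, continuous c} -> W (c t) -> \forall u \near t, W (c u).
Proof. by move=> ct it; apply: near_preimage => //; exact: (arc_open hW). Qed.

(** The coordinate of a curve in an arclength chart, from its coordinate in the
    chart [j]. *)
Lemma arc_derive (c : R -> M) (t : R) (j : atlas G) :
  {for t, continuous c} -> W (c t) -> cdom (ch j) (c t) ->
  derivable (cmap (ch j) \o c) t 1 ->
  is_derive t 1 (sigma \o c) (derive1 (sigma \o cinv (ch j)) (cmap (ch j) (c t)) *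
                              derive1 (cmap (ch j) \o c) t).
Proof.
move=> ct Wt jt dk.
have Wx' : W (cinv (ch j) (cmap (ch j) (c t))) by rewrite cmapK.
have [dD _ _] := arc_sigma_unit hW (cmap_img jt) Wx'.
have := @is_derive1_comp _ (sigma \o cinv (ch j)) (cmap (ch j) \o c) t _ _
  (derivable_is_derive dD) (derivable_is_derive dk).
apply: near_eq_is_derive.
by near=> u; rewrite /= cmapK//; near: u; exact: near_cdom.
Unshelve. all: by end_near. Qed.

Lemma rnorm_velocity (c : R -> M) (t : R) :
  {for t, continuous c} -> W (c t) ->
  derivable (cmap (ch (chart_at G (c t))) \o c) t 1 ->
  rnorm G (c t) (velocity G c t) = `|derive1 (sigma \o c) t|.
Proof.
move=> ct Wt dk; rewrite rnorm_arc//.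
by rewrite (is_derive_derive1 (arc_derive ct Wt (chart_atP G (c t)) dk)).
Qed.

(** [gamma] and [sigma] being inverse to each other, so are their derivatives. *)
Lemma gamma_darc (j : atlas G) (s : R) : `|s| < L -> cdom (ch j) (gamma s) ->
  derive1 (sigma \o cinv (ch j)) (cmap (ch j) (gamma s)) *
  derive1 (cmap (ch j) \o gamma) s = 1.
Proof.
move=> sL js; have [Ws _ cs] := arc_sigmaK hW sL.
have [dT _ _] := arc_gamma_unit hW sL js.
have := is_derive_derive1 (arc_derive cs Ws js dT) => <-.
apply: is_derive_derive1; apply: (@near_eq_is_derive R R R id).
near=> r => /=; have rL : `|r| < L by near: r; exact: near_norm_lt.
by have [_ -> _] := arc_sigmaK hW rL.
Unshelve. all: by end_near. Qed.

Lemma near_sigma_unit (j : atlas G) (u : R) :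
  cimg (ch j) u -> W (cinv (ch j) u) ->
  \forall v \near u, cimg (ch j) v /\ W (cinv (ch j) v).
Proof.
move=> ju Wu; apply: filterI; first by apply: open_nbhs_nbhs; split => //; exact: cimg_open.
by apply: near_W => //; exact: cinv_continuous.
Qed.

(** In an arclength chart the geodesic equation says that the second derivative
    of the coordinate is zero. *)
Lemma geodesic_arc (c : R -> M) (t : R) :
  (\forall u \near t, {for u, continuous c}) -> geodesic_at G c t -> W (c t) ->
  derivable (sigma \o c) t 1 /\
  (is_derive t 1 (derive1 (sigma \o c)) 0).
Proof.
move=> nct [ct geo] Wt; set j := chart_at G (c t).
have jt : cdom (ch j) (c t) := chart_atP G (c t).
have [ndk [ddk eqk]] := geo j jt; move: ndk ddk eqk.
set k := cmap (ch j) \o c => ndk ddk eqk.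
have dk : derivable k t 1 := nbhs_singleton ndk.
pose D := sigma \o cinv (ch j).
have kt : cimg (ch j) (k t) := cmap_img jt.
have Wk : W (cinv (ch j) (k t)) by rewrite /k/= cmapK.
have [dD ddD D2] := arc_sigma_unit hW kt Wk; rewrite -/D in dD ddD D2.
split; first exact: is_derive_derivable (arc_derive ct Wt jt dk).
have g0 := metric_gt0 kt.
have D0 : derive1 D (k t) != 0.
  by apply/eqP => D0; move: D2 g0; rewrite D0 expr0n/= => <-; rewrite ltxx.
have dg : derive1 (metric j) (k t) = 2 * derive1 D (k t) * derive1 (derive1 D) (k t).
  apply: is_derive_derive1.
  have dD' := derivable_is_derive ddD.
  have := @is_deriveM R R _ _ _ _ _ _ dD' dD'.
  rewrite /GRing.scale/= => H.
  have {}H : is_derive (k t) 1 (derive1 D * derive1 D)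
      (2 * derive1 D (k t) * derive1 (derive1 D) (k t)).
    by apply: is_derive_eq H _; ring.
  apply: near_eq_is_derive H.
  near=> v; have [jv Wv] : cimg (ch j) v /\ W (cinv (ch j) v).
    by near: v; exact: near_sigma_unit.
  by have [_ _ <-] := arc_sigma_unit hW jv Wv.
have dDk := is_derive1_comp (derivable_is_derive ddD) (derivable_is_derive dk).
have := @is_deriveM R R _ _ _ _ _ _ dDk (derivable_is_derive ddk).
rewrite /GRing.scale/= => H.
have {}H : is_derive t 1 ((derive1 D \o k) * derive1 k) 0.
  apply: is_derive_eq H _.
  have -> : derive1 (derive1 k) t = - (christoffel j (k t) * derive1 k t ^+ 2).
    by apply/eqP; rewrite -addr_eq0; apply/eqP.
  by rewrite /christoffel dg -D2; field.
apply: near_eq_is_derive H.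
have n1 := near_W ct Wt; have n2 := near_cdom ct jt.
near=> u; apply/esym/is_derive_derive1/arc_derive; by near: u.
Unshelve. all: by end_near. Qed.


Lemma line_derive (i : atlas G) (s0 a t : R) :
  let c := fun t : R => gamma (s0 + a * t) in let k := cmap (ch i) \o c in
  let T := cmap (ch i) \o gamma in let s := s0 + a * t in
  `|s| < L -> cdom (ch i) (c t) ->
  [/\ {for t, continuous c}, is_derive t 1 k (derive1 T s * a) &
      is_derive t 1 (derive1 k) (derive1 (derive1 T) s * a * a)].
Proof.
move=> c k T s sL it.
have dl (r : R) : is_derive r 1 (fun t : R => s0 + a * t) a.
  have H := @is_deriveZ R R R id a r 1 1 (is_derive_id _ _).
  have := @is_deriveD R R R (cst s0) _ r 1 0 _ (is_derive_cst _ _ _) H.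
  by rewrite add0r /GRing.scale/= mulr1.
have cl (r : R) : {for r, continuous (fun t : R => s0 + a * t)}.
  exact/derivable_continuous/is_derive_derivable.
have ct : {for t, continuous c}.
  by apply: continuous_comp; [exact: cl|by have [_ _] := arc_sigmaK hW sL].
have dk (r : R) : `|s0 + a * r| < L -> cdom (ch i) (c r) ->
    is_derive r 1 k (derive1 T (s0 + a * r) * a).
  move=> rL ir; have [dT _ _] := arc_gamma_unit hW rL ir.
  exact: (@is_derive1_comp _ T (fun t : R => s0 + a * t) r _ _
    (derivable_is_derive dT) (dl r)).
split => //; first exact: dk.
have [_ ddT _] := arc_gamma_unit hW sL it.
have H := @is_derive1_comp _ (derive1 T) (fun t : R => s0 + a * t) t _ _
  (derivable_is_derive ddT) (dl t).
have {}H : is_derive t 1 (fun r : R => derive1 T (s0 + a * r) * a)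
    (derive1 (derive1 T) s * a * a).
  have := @is_deriveZ R R R _ a _ _ _ H; rewrite /GRing.scale/= => {}H.
  have := H; have -> : (a \*: (derive1 T \o (fun t : R => s0 + a * t))) =
    (fun r : R => derive1 T (s0 + a * r) * a).
    by apply/funext => r /=; rewrite /GRing.scale/= mulrC.
  by move=> {}H; apply: is_derive_eq H _; rewrite mulrC.
apply: near_eq_is_derive H.
have n1 : \forall r \near t, `|s0 + a * r| < L.
  exact: (cl t _ (near_norm_lt sL)).
have n2 := near_cdom ct it.
near=> r; apply/esym/is_derive_derive1/dk; by near: r.
Unshelve. all: by end_near. Qed.

(** Conversely an affine motion along an arclength chart is a geodesic: it solves the
    geodesic equation in every chart. *)
Lemma line_geodesic (s0 a t : R) : `|s0 + a * t| < L ->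
  geodesic_at G (fun t => gamma (s0 + a * t)) t.
Proof.
move=> sL; set s := s0 + a * t; set c := fun t => _.
have [Ws _ cs] := arc_sigmaK hW sL.
have [ct _ _] := line_derive sL (chart_atP G (c t)).
split => // i it k.
have [_ dk ddk] := line_derive sL it.
have cl : {for t, continuous (fun t : R => s0 + a * t)}.
  by apply: cvgD; [exact: cvg_cst|apply: cvgM; [exact: cvg_cst|exact: cvg_id]].
have n1 : \forall r \near t, `|s0 + a * r| < L.
  exact: (cl _ (near_norm_lt sL)).
split.
  apply: filterS2 n1 (near_cdom ct it) => r rL ir.
  by have [_ dkr _] := line_derive rL ir; exact: is_derive_derivable dkr.
split; first exact: is_derive_derivable ddk.
rewrite /= (is_derive_derive1 ddk) (is_derive_derive1 dk).
have [dT ddT g1] := arc_gamma_unit hW sL it.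
move: g1 dT ddT; set T := cmap (ch i) \o gamma; rewrite -/s => g1 dT ddT.
have Ts : cimg (ch i) (T s) := cmap_img it.
have g0 := metric_gt0 Ts.
have T0 : derive1 T s != 0.
  by apply/eqP => T0; move/eqP: g1; rewrite T0 expr0n/= mulr0 eq_sym oner_eq0.
(* The derivative of the unit speed identity g(T) T'^2 = 1, which relates T'' to the
   Christoffel symbol. *)
have E : derive1 (metric i) (T s) * derive1 T s * derive1 T s ^+ 2 +
    metric i (T s) * (2 * derive1 T s * derive1 (derive1 T) s) = 0.
  have dg := is_derive1_comp (derivable_is_derive (metric_derivable Ts)) (derivable_is_derive dT).
  have dT2 := @is_deriveM R R _ _ _ _ _ _ (derivable_is_derive ddT) (derivable_is_derive ddT).
  have H := @is_deriveM R R _ _ _ _ _ _ dg dT2.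
  have H0 : is_derive s 1 ((metric i \o T) * (derive1 T * derive1 T)) 0.
    apply: (@near_eq_is_derive R R R (cst 1)).
    have n3 := near_norm_lt sL; have n4 := near_cdom cs it.
    near=> r; have rL : `|r| < L by near: r.
    have ir : cdom (ch i) (gamma r) by near: r.
    by have [_ _ <-] := arc_gamma_unit hW rL ir.
  have := is_derive_derive1 H; rewrite (is_derive_derive1 H0) /GRing.scale/= => ->.
  by rewrite !fctE /=; ring.
rewrite /christoffel /k /= -/s -/(T s).
have -> : derive1 (metric i) (T s) =
    - (metric i (T s) * (2 * derive1 (derive1 T) s)) / derive1 T s ^+ 2.
  apply: (mulIf (expf_neq0 3 T0)); rewrite -[RHS]addr0 -E; field.
  by rewrite T0.
by field; rewrite T0 gt_eqF.
Unshelve. all: by end_near. Qed.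

End arc_chart_theory.

(** * Geodesics and the exponential map *)

Section arc_chart_geodesics.
Variables (R : realType) (M : topologicalType) (G : riemannian1 R M).
Local Notation ch i := (chart_of (r := G) i).
Variables (L : R) (W : set M) (sigma : M -> R) (gamma : R -> M).
Hypothesis hW : arc_chart G L W sigma gamma.

(** Uniqueness of geodesics, by connectedness of [0, 1]: a geodesic issued from a
    point of an arclength chart is affine in the coordinate as long as the affine
    function stays in the range of the coordinate. *)
Lemma geodesic_line (c : R -> M) (e : R) (s0 a : R) :
  0 < e -> (forall t : R, - e < t < 1 + e -> geodesic_at G c t) ->
  W (c 0) -> sigma (c 0) = s0 -> derive1 (sigma \o c) 0 = a ->
  (forall t : R, 0 <= t <= 1 -> `|s0 + a * t| < L) ->
  forall t : R, 0 <= t <= 1 -> c t = gamma (s0 + a * t).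
Proof.
move=> e0 geo W0 c0 c'0 sL.
pose h := sigma \o c.
have local (t : R) : - e < t < 1 + e -> W (c t) ->
    \forall u \near t, W (c u) /\ (h u = h t + derive1 h t * (u - t) /\
                                   derive1 h u = derive1 h t).
  move=> te Wt; have [ct _] := geo t te.
  have n1 := near_oo te.
  have n2 := near_W hW ct Wt.
  apply: filterI => //; apply: near_affine.
  have n3 : \forall u \near t, \forall v \near u, {for v, continuous c}.
    apply: near_join; apply: filterS n1 => u /geo[]; by [].
  apply: filterS3 n1 n2 n3 => u /geo gu Wu cu.
  exact: (geodesic_arc hW cu gu Wu).
(* The set of good times is open by [local], and closed because M is Hausdorff. *)
pose good : set R := [set t | [/\ W (c t), h t = s0 + a * t & derive1 h t = a]].
have good_near (t : R) : - e < t < 1 + e -> good t -> \forall u \near t, good u.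
  move=> te [Wt ht h't]; apply: filterS (local t te Wt) => u [Wu [hu h'u]].
  by split => //; rewrite ?h'u// hu ht h't; ring.
have good_c t : good t -> c t = gamma (s0 + a * t).
  by move=> [Wt <- _]; have [_ ->] := arc_gammaK hW Wt.
have te (t : R) : 0 <= t <= 1 -> - e < t < 1 + e by lra.
have cl (t : R) : 0 <= t <= 1 -> closure (`[0, 1] `&` good) t -> good t.
  move=> t01 clt; have [ct _] := geo t (te t t01).
  have [Wg sg cg] := arc_sigmaK hW (sL t t01).
  have cl' : {for t, continuous (fun t : R => gamma (s0 + a * t))}.
    apply: (@continuous_comp _ _ _ (fun t : R => s0 + a * t) gamma) => //.
    by apply: cvgD; [exact: cvg_cst|apply: cvgM; [exact: cvg_cst|exact: cvg_id]].
  have ctE : c t = gamma (s0 + a * t).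
    apply: (r_hausdorff G) => A B nA nB.
    have nA' : \forall u \near t, A (c u) by exact: ct.
    have nB' : \forall u \near t, B (gamma (s0 + a * u)) by exact: cl'.
    have [u [[_ /good_c cu] [Au Bu]]] := clt _ (filterI nA' nB').
    by exists (c u); split => //; rewrite cu.
  have Wt : W (c t) by rewrite ctE.
  have [u [[_ [_ _ h'u]] [_ [_ h'ut]]]] := clt _ (local t (te t t01) Wt).
  by split => //; [rewrite /h/= ctE sg|rewrite -h'ut].
have /seteqP[_ all] : `[0, 1] `&` good = `[0, 1]%classic.
  apply: segment_connected.
  - exists 0; split; first by rewrite /= in_itv/= lexx ler01.
    by split => //; rewrite /h/= c0 mulr0 addr0.
  - exists (interior good); first exact: open_interior.
    apply/seteqP; split => t [t01 gt]; split => //.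
      by apply: good_near => //; apply: te; move: t01; rewrite /= in_itv.
    exact: nbhs_singleton.
  - exists (closure (`[0, 1] `&` good)); first exact: closed_closure.
    apply/seteqP; split => t [t01 gt]; split => //.
      by apply: subset_closure.
    by apply: cl => //; move: t01; rewrite /= in_itv.
by move=> t t01; apply: good_c; have [] : (`[0, 1] `&` good) t
  by apply: all; rewrite /= in_itv.
Qed.

(** The exponential map adds to the coordinate of [x] the component of [v] along the
    unit field of the arclength chart. *)
Lemma rexp_arc (x : M) (v : R) : W x ->
  `|sigma x| + `|darc G sigma x * v| < L ->
  rexp G x v = gamma (sigma x + darc G sigma x * v).
Proof.
move=> Wx; set a := darc G sigma x * v => aL.
have [_ xK] := arc_gammaK hW Wx.
have lineL (t : R) : `|a| * `|t| < L - `|sigma x| -> `|sigma x + a * t| < L.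
  move=> tL; apply: le_lt_trans (ler_normD _ _) _; rewrite normrM; lra.
have L0 : `|sigma x + a * 0| < L by apply: lineL; rewrite normr0 mulr0; have := normr_ge0 a; lra.
apply: xget_unique => [|y [c [[e e0 geo] c0 c'0 c1]]].
  exists (fun t => gamma (sigma x + a * t)).
  have c0 : gamma (sigma x + a * 0) = x by rewrite mulr0 addr0.
  split => //; last by rewrite mulr1.
  (* With this q the line is still in the chart on ]- q, 1 + q[, as
     |sigma x| + |a| (1 + q) = L - q. *)
  - pose q := (L - `|sigma x| - `|a|) / (`|a| + 1).
    have a0 := normr_ge0 a; have a1 : 0 < `|a| + 1 by lra.
    have q0 : 0 < q by apply: divr_gt0 => //; lra.
    have qE : q * (`|a| + 1) = L - `|sigma x| - `|a| by rewrite /q divfK ?gt_eqF.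
    exists q => // t tq; apply: (line_geodesic hW); apply: lineL.
    have : `|a| * `|t| <= `|a| * (1 + q).
      by apply: ler_wpM2l => //; rewrite ler_norml; lra.
    by rewrite mulrDr mulr1 [_ * q]mulrC; lra.
  - rewrite /velocity c0; set j := chart_at G x.
    have jx : cdom (ch j) (gamma (sigma x + a * 0)) by rewrite c0; exact: chart_atP.
    have [_ dk _] := line_derive hW L0 jx.
    rewrite (is_derive_derive1 dk) /a mulrA.
    have := gamma_darc hW L0 jx; rewrite c0 -/j -/(darc G sigma x) => E.
    by rewrite [X in X * _]mulrC E mul1r.
have ct0 : geodesic_at G c 0 by apply: geo; lra.
have j0 := chart_atP G (c 0).
have d0 : derive1 (sigma \o c) 0 = a.
  have [cc geo0] := ct0; have [/nbhs_singleton dk _] := geo0 _ j0.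
  have Wc0 : W (c 0) by rewrite c0.
  rewrite (is_derive_derive1 (arc_derive hW cc Wc0 j0 dk)).
  by rewrite -[X in _ * X]/(velocity G c 0) c'0 /a /darc c0.
have Wc0 : W (c 0) by rewrite c0.
have sc0 : sigma (c 0) = sigma x by rewrite c0.
rewrite -c1 (geodesic_line e0 geo Wc0 sc0 d0) ?mulr1 ?lexx ?ler01//.
move=> t t01; apply: lineL; have := normr_ge0 a.
have /andP[t0 t1] := t01; rewrite (ger0_norm t0) => a0.
by have := ler_wpM2l a0 t1; rewrite mulr1; lra.
Qed.

End arc_chart_geodesics.

(** * The Riemannian distance *)

Section arc_chart_distance.
Variables (R : realType) (M : topologicalType) (G : riemannian1 R M).
Local Notation ch i := (chart_of (r := G) i).

Section speed.
Variables (L : R) (W : set M) (sigma : M -> R) (gamma : R -> M).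
Hypothesis hW : arc_chart G L W sigma gamma.

Lemma arc_C1 (c : R -> M) (t : R) :
  (\forall u \near t, C1_at G c u) -> W (c t) ->
  (\forall u \near t, derivable (sigma \o c) u 1) /\
  {for t, continuous (derive1 (sigma \o c))}.
Proof.
move=> nC Wt; have [ct Ct] := nbhs_singleton nC.
set j := chart_at G (c t); have jt : cdom (ch j) (c t) := chart_atP G (c t).
pose k := cmap (ch j) \o c; pose D := sigma \o cinv (ch j).
have dE : \forall u \near t, is_derive (u : R) 1 (sigma \o c) (derive1 D (k u) * derive1 k u).
  apply: filterS3 nC (near_W hW ct Wt) (near_cdom ct jt) => u [cu Cu] Wu ju.
  exact: (arc_derive hW cu Wu ju (Cu _ ju).1).
split; first by apply: filterS dE => u; exact: is_derive_derivable.
have [dk ck] := Ct j jt.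
apply: (@near_eq_continuous _ _ (fun u => derive1 D (k u) * derive1 k u)).
  by apply: filterS dE => u /is_derive_derive1.
have Wk : W (cinv (ch j) (k t)) by rewrite /k/= cmapK.
have [_ /derivable_continuous cD _] := arc_sigma_unit hW (cmap_img jt) Wk.
have cDk : {for t, continuous (derive1 D \o k)}.
  exact: (@continuous_comp R R R k (derive1 D) t (derivable_continuous dk) cD).
by apply: cvgM; [exact: cDk|exact: ck].
Qed.

Lemma speed_arc (c : R -> M) (t : R) :
  C1_at G c t -> W (c t) ->
  rnorm G (c t) (velocity G c t) = `|derive1 (sigma \o c) t|.
Proof.
move=> [ct Ct] Wt.
exact: (rnorm_velocity hW ct Wt (Ct _ (chart_atP G (c t))).1).
Qed.

End speed.

Lemma speed_continuous (c : R -> M) (t : R) :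
  (\forall u \near t, C1_at G c u) ->
  {for t, continuous (fun u => rnorm G (c u) (velocity G c u))}.
Proof.
move=> nC; have [ct _] := nbhs_singleton nC.
have [L [W [sigma [gamma [hW Wt _]]]]] := arc_chart_exists G (c t).
have [_ cd] := arc_C1 hW nC Wt.
apply: (@near_eq_continuous _ _ (fun u => `|derive1 (sigma \o c) u|)).
  by apply: filterS2 nC (near_W hW ct Wt) => u Cu Wu; rewrite (speed_arc hW).
by apply: (@continuous_comp _ _ _ (derive1 (sigma \o c)) (fun y : R => `|y|)) => //;
  exact: norm_continuous.
Qed.

Section distance.
Variables (L : R) (W : set M) (sigma : M -> R) (gamma : R -> M).
Hypothesis hW : arc_chart G L W sigma gamma.

Lemma line_C1 (s0 a t : R) : `|s0 + a * t| < L ->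
  C1_at G (fun t => gamma (s0 + a * t)) t.
Proof.
move=> sL; have [ct _ _] := line_derive hW sL (chart_atP G _).
split => // i it; have [_ dk ddk] := line_derive hW sL it.
by split; [exact: is_derive_derivable dk|
           exact/derivable_continuous/(is_derive_derivable ddk)].
Qed.

(** The upper bound is the length of the segment of the arclength chart. *)
Lemma rdist_arc_le (d a b : R) : 2 * d < L -> `|a| <= d -> `|b| <= d ->
  (rdist G (gamma a) (gamma b) <= `|a - b|%:E)%E.
Proof.
move=> dL ad bd; pose c t := gamma (a + (b - a) * t).
(* Between -1/2 and 3/2 an affine function is bounded by twice the maximum of its
   absolute values at 0 and 1. *)
have tL (t : R) : - 2^-1 < t < 1 + 2^-1 -> `|a + (b - a) * t| < L.
  move=> /andP[t1 t2]; move: ad bd; rewrite !ler_norml => /andP[a1 a2] /andP[b1 b2].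
  by rewrite ltr_norml; apply/andP; split; nra.
have tC (t : R) : - 2^-1 < t < 1 + 2^-1 -> C1_at G c t.
  by move=> /tL; exact: line_C1.
have half : 0 < 2^-1 :> R by rewrite invr_gt0.
apply: ge_ereal_inf; exists (curve_length G c).
  exists c => //; split; first by exists 2^-1.
  by rewrite /c mulr0 addr0 mulr1 addrC subrK.
rewrite /curve_length (eq_integral (fun=> `|a - b|%:E)).
  by rewrite integral_cst//= lebesgue_measure_itv/= lte_fin ltr01 sube0 mule1.
move=> t; rewrite inE/= in_itv/= => /andP[t0 t1].
have te : - 2^-1 < t < 1 + 2^-1 by lra.
have [Wt _ _] := arc_sigmaK hW (tL t te).
rewrite (speed_arc hW (tC t te) Wt); congr EFin.
suff -> : derive1 (sigma \o c) t = b - a by rewrite distrC.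
apply: is_derive_derive1.
have H := @is_deriveZ R R R id (b - a) t 1 1 (is_derive_id _ _).
have := @is_deriveD R R R (cst a) _ t 1 0 _ (is_derive_cst _ _ _) H.
rewrite add0r /GRing.scale/= mulr1; apply: near_eq_is_derive.
apply: filterS (near_oo te) => u /tL uL; rewrite /c/=.
by have [_ -> _] := arc_sigmaK hW uL.
Qed.

(** A curve joining the two points cannot be shorter than the difference of the
    coordinates, even if it leaves the arclength chart: its length bounds the
    variation along it of a truncation of [sigma] which is 1-Lipschitz, equal to
    [sigma] at both ends, and extended by 0 to the whole of [M]. *)
Lemma rdist_arc_ge (d a b : R) : 0 < d -> 5 * d < L -> `|a| <= d -> `|b| <= d ->
  (`|a - b|%:E <= rdist G (gamma a) (gamma b))%E.
Proof.
move=> d0 dL ad bd.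
have [chi [w [dchi cw w1 chi_id chi0]]] := cutoff_id d0.
(* The compact set K contains the support of the truncated coordinate F; being
   closed, it makes F vanish near the points outside W. *)
pose K := gamma @` `[- (5 * d), 5 * d]%classic.
have cK : closed K.
  apply: compact_closed; first exact: (r_hausdorff G).
  apply: continuous_compact; last exact: segment_compact.
  apply: continuous_in_subspaceT => s; rewrite inE/= in_itv/= => sd.
  have sL : `|s| < L by rewrite ltr_norml; lra.
  by have [_ _] := arc_sigmaK hW sL.
pose F x : R := if pselect (W x) then chi (sigma x) else 0.
have FW x : W x -> F x = chi (sigma x) by rewrite /F; case: pselect.
have FK x : ~ K x -> F x = 0.
  move=> nK; rewrite /F; case: pselect => // Wx; apply: chi0.
  rewrite leNgt; apply/negP => sd; apply: nK.
  exists (sigma x); last by have [] := arc_gammaK hW Wx.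
  by rewrite /= in_itv/=; move: sd; rewrite ltr_norml; lra.
have Fend s : `|s| <= d -> F (gamma s) = s.
  move=> sd; have sL : `|s| < L by lra.
  by have [Ws ss _] := arc_sigmaK hW sL; rewrite FW// ss chi_id.
apply: le_ereal_inf_tmp => _ [c [[e e0 C] [c0 c1]] <-].
rewrite -{1}(Fend a ad) -{1}(Fend b bd) -c0 -c1 distrC.
pose f t := derive1 (F \o c) t.
have nC (t : R) : 0 <= t <= 1 -> \forall u \near t, C1_at G c u.
  move=> t01; have te : - e < t < 1 + e by lra.
  by apply: filterS (near_oo te) => u; exact: C.
have main (t : R) : 0 <= t <= 1 -> [/\ derivable (F \o c) t 1, {for t, continuous f} &
    `|f t| <= rnorm G (c t) (velocity G c t)].
  move=> t01; have nCt := nC t t01; have Ct := nbhs_singleton nCt.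
  have [ct _] := Ct.
  have [Wt|nWt] := pselect (W (c t)).
    have [nd cd] := arc_C1 hW nCt Wt.
    have dF : \forall u \near t, is_derive (u : R) 1 (F \o c)
        (w (sigma (c u)) * derive1 (sigma \o c) u).
      have nW : \forall u \near t, \forall v \near u, W (c v).
        by apply: near_join; exact: (near_W hW ct Wt).
      apply: filterS2 nd nW => u du nWu.
      have H := @is_derive1_comp _ chi (sigma \o c) u _ _ (dchi _) (derivable_is_derive du).
      apply: near_eq_is_derive H.
      by apply: filterS nWu => v Wv; rewrite /= FW.
    have dFt := nbhs_singleton dF.
    split; first exact: is_derive_derivable dFt.
      apply: (@near_eq_continuous _ _ (fun u => w (sigma (c u)) * derive1 (sigma \o c) u)).
        by apply: filterS dF => u /is_derive_derive1.
      apply: cvgM; last exact: cd.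
      apply: (@continuous_comp _ _ _ (sigma \o c) w); last exact: cw.
      exact/derivable_continuous/(nbhs_singleton nd).
    rewrite /f (is_derive_derive1 dFt) (speed_arc hW Ct Wt) normrM.
    by rewrite ler_piMl.
  have nKt : ~ K (c t).
    move=> [s /=]; rewrite in_itv/= => sd cs; apply: nWt; rewrite -cs.
    have sL : `|s| < L by rewrite ltr_norml; lra.
    by have [] := arc_sigmaK hW sL.
  have nF : \forall u \near t, \forall v \near u, F (c v) = 0.
    apply: near_join; have : \forall u \near t, (~` K) (c u).
      by apply: near_preimage => //; exact: closed_openC.
    by apply: filterS => u; exact: FK.
  have dF : \forall u \near t, is_derive (u : R) 1 (F \o c) 0.
    apply: filterS nF => u nFu.
    apply: (@near_eq_is_derive R R R (cst 0)).
    by apply: filterS nFu => v /= ->.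
  have dFt := nbhs_singleton dF.
  split; first exact: is_derive_derivable dFt.
    apply: (@near_eq_continuous _ _ (cst 0)); last exact: cst_continuous.
    by apply: filterS dF => u /is_derive_derive1.
  by rewrite /f (is_derive_derive1 dFt) normr0 /rnorm sqrtr_ge0.
have dF (t : R) : 0 <= t <= 1 -> is_derive t 1 (F \o c) (f t).
  by move=> t01; have [? _ _] := main t t01; exact: derivable_is_derive.
have cf (t : R) : 0 <= t <= 1 -> {for t, continuous f}.
  by move=> t01; have [] := main t t01.
have cg (t : R) : 0 <= t <= 1 ->
    {for t, continuous (fun u => rnorm G (c u) (velocity G c u))}.
  by move=> t01; exact/speed_continuous/nC.
have fg (t : R) : 0 <= t <= 1 -> `|f t| <= rnorm G (c t) (velocity G c t).
  by move=> t01; have [] := main t t01.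
exact: (variation_le_integral dF cf cg fg).
Qed.

Lemma rdist_arc (d a b : R) : 0 < d -> 5 * d < L -> `|a| <= d -> `|b| <= d ->
  rdist G (gamma a) (gamma b) = `|a - b|%:E.
Proof.
move=> d0 dL ad bd; apply/eqP; rewrite eq_le (rdist_arc_ge d0 dL ad bd) andbT.
by apply: (@rdist_arc_le d) => //; lra.
Qed.

End distance.
End arc_chart_distance.

(** * The cone over a line *)

(** Polar coordinates of the point [(r m, r nu)] of the right half-plane. *)
Lemma polar_atan (R : realType) (r m nu : R) : 0 < r -> 0 < m ->
  let rho := Num.sqrt ((r * m) ^+ 2 + (r * nu) ^+ 2) in
  rho * cos (atan (nu / m)) = r * m /\ rho * sin (atan (nu / m)) = r * nu.
Proof.
move=> r0 m0 rho.
have q0 : 0 < 1 + (nu / m) ^+ 2 by rewrite ltr_pwDl// sqr_ge0.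
have rhoE : rho = r * m * Num.sqrt (1 + (nu / m) ^+ 2).
  rewrite /rho -[r * m in RHS]gtr0_norm ?mulr_gt0// -sqrtr_sqr -sqrtrM ?sqr_ge0//.
  by congr Num.sqrt; field; rewrite gt_eqF.
have c : rho * cos (atan (nu / m)) = r * m.
  by rewrite rhoE cos_atan mulfK// gt_eqF// sqrtr_gt0.
split => //.
have cn0 : cos (atan (nu / m)) != 0 by rewrite cos_atan invr_eq0 gt_eqF// sqrtr_gt0.
have : tan (atan (nu / m)) = nu / m by exact: atanK.
rewrite /tan => /(canRL (divfK cn0)) ->.
by rewrite mulrCA c; field; rewrite gt_eqF.
Qed.

(** The cone over an interval is flat: in the planar polar coordinates (rho, alpha)
    the cone distance is the Euclidean one. *)
Lemma polar_dist (R : realType) (r m nu m' nu' : R) : 0 < r -> 0 < m -> 0 < m' ->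
  let rho := Num.sqrt ((r * m) ^+ 2 + (r * nu) ^+ 2) in
  let rho' := Num.sqrt ((r * m') ^+ 2 + (r * nu') ^+ 2) in
  rho ^+ 2 + rho' ^+ 2 - 2 * rho * rho' *
    cos (fine (mine (`|atan (nu / m) - atan (nu' / m')|%:E) pi%:E)) =
  r ^+ 2 * ((m - m') ^+ 2 + (nu - nu') ^+ 2).
Proof.
move=> r0 m0 m0' rho rho'; set a := atan _; set b := atan _.
have abpi : `|a - b| < pi.
  have := atan_ltpi2 (nu / m); have := atan_gtNpi2 (nu / m).
  have := atan_ltpi2 (nu' / m'); have := atan_gtNpi2 (nu' / m').
  by rewrite -/a -/b ltr_norml; lra.
have -> : mine (`|a - b|%:E) pi%:E = `|a - b|%:E by rewrite min_l// lee_fin ltW.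
have -> : cos (fine `|a - b|%:E) = cos a * cos b + sin a * sin b.
  by rewrite /= cos_norm cosB.
have [ca sa] := polar_atan nu r0 m0; have [cb sb] := polar_atan nu' r0 m0'.
have -> : 2 * rho * rho' * (cos a * cos b + sin a * sin b) =
    2 * ((rho * cos a) * (rho' * cos b) + (rho * sin a) * (rho' * sin b)) by ring.
rewrite ca cb sa sb !sqr_sqrtr ?addr_ge0 ?sqr_ge0//; ring.
Qed.

Lemma cone_repr_pt (R : realType) (M : ptopologicalType) (x : M) (r : halfline R) :
  nnval r != 0 -> cone_repr (cone_pt (x, r)) = (x, r).
Proof.
move=> r0; have : cone_rel (cone_repr (cone_pt (x, r))) (x, r).
  by apply/cone_ptE; rewrite cone_reprK.
by rewrite /cone_rel (negbTE r0) andbF orbF => /eqP.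
Qed.

Lemma cone_repr_apex (R : realType) (M : ptopologicalType) (x : M) (r : halfline R) :
  nnval r = 0 -> nnval (cone_repr (cone_pt (x, r))).2 = 0.
Proof.
move=> r0; have : cone_rel (cone_repr (cone_pt (x, r))) (x, r).
  by apply/cone_ptE; rewrite cone_reprK.
by rewrite /cone_rel => /orP[/eqP-> //|/andP[/eqP]].
Qed.

(** The vectors at the apex vanish, so that both exponentials are the apex itself. *)
Lemma cone_dist_apex (R : realType) (M : ptopologicalType) (G : riemannian1 R M)
    (phi psi : M -> R) (s t : R) (x : M) (r : halfline R) : nnval r = 0 ->
  cone_dist G
    (cone_exp G (cone_pt (x, r)) (s *: (cone_grad G phi (cone_pt (x, r)) : R^o * R^o)))
    (cone_exp G (cone_pt (x, r)) (t *: (cone_grad G psi (cone_pt (x, r)) : R^o * R^o)))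
    ^+ 2 = 0.
Proof.
move=> r0; rewrite /cone_grad /cone_exp.
have := cone_repr_apex x r0; case: (cone_repr (cone_pt (x, r))) => y ry /= ->.
rewrite cone_distE /nnval /=.
by rewrite !(mulr0, mul0r, scaler0, add0r, addr0, expr0n, sqrtr0, oppr0).
Qed.

Section cone_over_line.
Variables (R : realType) (M : ptopologicalType) (G : riemannian1 R M).
Local Notation ch i := (chart_of (r := G) i).
Variables (L : R) (W : set M) (sigma : M -> R) (gamma : R -> M).
Hypothesis hW : arc_chart G L W sigma gamma.

Lemma darc_neq0 (x : M) : W x -> darc G sigma x != 0.
Proof.
move=> Wx; apply/eqP => D0; have := @rinner_arc _ _ _ _ _ _ _ hW x 1 1 Wx.
rewrite D0 mul0r mulr0 /rinner !mulr1 => g0.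
by have := metric_gt0 (cmap_img (chart_atP G x)); rewrite g0 ltxx.
Qed.

(** The vector [(v, r q)] has component [nu] along the unit field; its exponential is
    the point of polar coordinates [rho] and [sigma x + a], where [(rho, a)] are those
    of the point [(r (1 + q), r nu)] of the plane. *)
Lemma cone_exp_arc (x : M) (r : halfline R) (v q : R) :
  W x -> 0 < nnval r -> 0 < 1 + q ->
  let nu := darc G sigma x * v in let a := atan (nu / (1 + q)) in
  `|sigma x| + `|a| < L ->
  exists rho : halfline R,
    nnval rho = Num.sqrt ((nnval r * (1 + q)) ^+ 2 + (nnval r * nu) ^+ 2) /\
    cone_exp G (cone_pt (x, r)) (v, nnval r * q) = cone_pt (gamma (sigma x + a), rho).
Proof.
move=> Wx r0 q0 nu a aL; rewrite /cone_exp cone_repr_pt; last by rewrite gt_eqF.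
have D0 := darc_neq0 Wx; have nE := rnorm_arc hW v Wx; rewrite -/nu in nE.
eexists; split; last first.
  congr (cone_pt (_, _)).
  have [v0|v0] := eqVneq v 0.
    have -> : a = 0 by rewrite /a /nu v0 mulr0 mul0r atan0.
    by rewrite addr0; have [_ ->] := arc_gammaK hW Wx.
  have nu0 : nu != 0 by rewrite mulf_neq0.
  have E : darc G sigma x *
      (atan (nnval r * rnorm G x v / (nnval r + nnval r * q)) * (v / rnorm G x v)) = a.
    rewrite mulrCA (mulrA (darc G sigma x)) -/nu nE.
    have -> : nnval r * `|nu| / (nnval r + nnval r * q) = `|nu| / (1 + q).
      by field; rewrite !gt_eqF// -[X in X + _]mulr1 -mulrDr mulr_gt0.
    rewrite /a; have [n0|n0] := ger0P nu.
      by rewrite divff// mulr1.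
    by rewrite invrN mulrN divff// mulNr atanN mulrN1 opprK.
  by rewrite (rexp_arc hW Wx) E.
by rewrite /nnval/= nE real_normK ?num_real//; congr Num.sqrt; ring.
Qed.

(** For small tangent vectors the cone over [M] is isometric to the plane. *)
Lemma cone_dist_arc (x : M) (r : halfline R) (d v q v' q' : R) :
  W x -> 0 < nnval r -> 0 < 1 + q -> 0 < 1 + q' -> 0 < d -> 5 * d < L ->
  `|sigma x| + `|atan (darc G sigma x * v / (1 + q))| <= d ->
  `|sigma x| + `|atan (darc G sigma x * v' / (1 + q'))| <= d ->
  cone_dist G (cone_exp G (cone_pt (x, r)) (v, nnval r * q))
              (cone_exp G (cone_pt (x, r)) (v', nnval r * q')) ^+ 2 =
  nnval r ^+ 2 * ((q - q') ^+ 2 + rnorm G x (v - v') ^+ 2).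
Proof.
move=> Wx r0 q0 q0' d0 dL a1 b1.
have dL' : d < L by lra.
have [rho [rhoE ->]] := cone_exp_arc Wx r0 q0 (le_lt_trans a1 dL').
have [rho' [rhoE' ->]] := cone_exp_arc Wx r0 q0' (le_lt_trans b1 dL').
rewrite cone_distE (rdist_arc hW d0 dL (le_trans (ler_normD _ _) a1) (le_trans (ler_normD _ _) b1)).
have -> : forall s a b : R, s + a - (s + b) = a - b by move=> s a b; ring.
rewrite rhoE rhoE' polar_dist// (rnorm_arc hW)// mulrBr real_normK ?num_real//.
rewrite sqr_sqrtr; last by rewrite mulr_ge0 ?sqr_ge0// addr_ge0 ?sqr_ge0.
by congr (_ * (_ + _)); ring.
Qed.

Lemma sigma_continuous (x : M) : W x -> {for x, continuous sigma}.
Proof.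
move=> Wx; set j := chart_at G x; have jx : cdom (ch j) x := chart_atP G x.
have Wj : W (cinv (ch j) (cmap (ch j) x)) by rewrite cmapK.
have [/derivable_continuous cD _ _] := arc_sigma_unit hW (cmap_img jx) Wj.
apply: (@near_eq_continuous _ _ ((sigma \o cinv (ch j)) \o cmap (ch j))).
  have : \forall y \near x, cdom (ch j) y.
    by apply: open_nbhs_nbhs; split => //; exact: cdom_open.
  by apply: filterS => y jy /=; rewrite cmapK.
exact: (@continuous_comp _ _ _ (cmap (ch j)) (sigma \o cinv (ch j)) x (cmap_continuous jx) cD).
Qed.

End cone_over_line.

(** * The lift of a measure to the cone *)

Lemma measurable_continuous_borel (R : realType) (M : ptopologicalType) (h : M -> R) :
  continuous h -> measurable_fun [set: borel M] (h : borel M -> R).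
Proof.
move=> ch mT; apply: (measurability _ (RGenOpens.measurableE R)) => //.
move=> _ [_ [x [y ->]] <-]; rewrite setTI; apply: sub_sigma_algebra.
by apply: open_comp; [move=> z _; exact: ch|exact: interval_open].
Qed.

Lemma measurable_nnval (R : realType) : measurable_fun [set: halfline R] (@nnval R).
Proof. 
by move=> _ A mA; exists A.
Qed.

Lemma measurable_cone (R : realType) (M : ptopologicalType) (f : cone R M -> R) :
  measurable_fun [set: borel M * halfline R] (f \o @cone_pt R M) ->
  measurable_fun [set: cone R M] f.
Proof.
move=> mf mT A mA; have := mf measurableT A mA; rewrite !setTI => H.
by rewrite /measurable /= /image_set_system /= setTI.
Qed.

(** Integration against the lift of [mu] to the cone, for 2-homogeneous integrands. *)
Lemma Rintegral_hat_mu (R : realType) (M : ptopologicalType)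
  (mu : {finite_measure set (borel M) -> \bar R}) (h : M -> R) (f : cone R M -> R) :
  mu setT <> 0%E -> (forall x, 0 <= h x) ->
  measurable_fun [set: borel M] (h : borel M -> R) ->
  (forall x r, f (cone_pt (x, r)) = nnval r ^+ 2 * h x) ->
  \int[hat_mu mu]_(p in [set: cone R M]) f p = \int[mu]_(x in [set: borel M]) h x.
Proof.
move=> mu0 h0 mh fE; congr fine.
have fcE : f \o @cone_pt R M = fun q => nnval q.2 ^+ 2 * h q.1.
  by apply/funext => -[x r]; exact: fE.
have mfc : measurable_fun [set: borel M * halfline R] (f \o @cone_pt R M).
  rewrite fcE; apply: measurable_funM.
    apply: measurable_funX.
    exact: (measurableT_comp (@measurable_nnval R) measurable_snd).
  exact: (measurableT_comp mh measurable_fst).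
have mf := measurable_cone mfc.
have f0 p : 0 <= f p.
  by rewrite -(cone_reprK p); case: (cone_repr p) => x r; rewrite fE mulr_ge0// sqr_ge0.
rewrite /hat_mu ge0_integral_mscale//; last 2 first.
- exact/measurable_EFinP.
- by move=> p _; rewrite lee_fin.
rewrite (@ge0_integral_pushforward _ _ _ _ _ _ (@measurable_cone_pt R M))//; last 2 first.
- exact/measurable_EFinP.
- by move=> p _; rewrite lee_fin.
rewrite preimage_setT fubini_tonelli1//=; last 2 first.
- exact/measurable_EFinP.
- by move=> p; rewrite lee_fin.
have rE (x : borel M) : (fubini_F (\d_ (mass_radius mu : halfline R))
    (fun q => (f (cone_pt q))%:E) x = (((mass_radius mu)%:num ^+ 2)%R)%:E * (h x)%:E)%E.
  rewrite /fubini_F integral_dirac//; first by rewrite diracT mul1e fE EFinM.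
  have -> : (fun r : halfline R => (f (cone_pt (x, r)))%:E) =
      (fun r => (nnval r ^+ 2 * h x)%:E) by apply/funext => r; rewrite fE.
  apply/measurable_EFinP; apply: measurable_funM; last exact: measurable_cst.
  by apply: measurable_funX; exact: measurable_nnval.
under eq_integral do rewrite rE.
have r0 : 0 < fine (mu setT).
  by rewrite lt_neqAle fine_ge0// andbT eq_sym fine_eq0 ?fin_num_measure//; apply/eqP.
rewrite ge0_integralZl_EFin//; last 2 first.
- by move=> x _; rewrite lee_fin.
- exact/measurable_EFinP.
rewrite muleA -EFinM mulVf ?mul1e// expf_neq0// gt_eqF// sqrtr_gt0.
exact: r0.
Qed.

(** * Gradients, and flatness of the cone for small tangent vectors *)

Section gradients.
Variables (R : realType) (M : ptopologicalType) (G : riemannian1 R M).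
Local Notation ch i := (chart_of (r := G) i).

(** Functions of class C^1 on [M], that is, in every chart. *)
Definition C1_fun (phi : M -> R) : Prop :=
  forall (i : atlas G) (u : R), cimg (ch i) u ->
    derivable (phi \o cinv (ch i)) u 1 /\
    {for u, continuous (derive1 (phi \o cinv (ch i)))}.

Lemma smooth_C1 (phi : M -> R) : smooth_fun G phi -> C1_fun phi.
Proof.
move=> sphi i u iu; split; first exact: (sphi i 0%N u iu).
exact: derivable_continuous (sphi i 1%N u iu).
Qed.

Lemma C1_is_derive_lin (phi psi : M -> R) (s t : R) (i : atlas G) (u : R) :
  C1_fun phi -> C1_fun psi -> cimg (ch i) u ->
  is_derive u 1 ((fun x => s * phi x - t * psi x) \o cinv (ch i))
    (s * derive1 (phi \o cinv (ch i)) u - t * derive1 (psi \o cinv (ch i)) u).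
Proof.
move=> Cphi Cpsi iu; have [dphi _] := Cphi i u iu; have [dpsi _] := Cpsi i u iu.
have H1 := @is_deriveZ R R R _ s u 1 _ (derivable_is_derive dphi).
have H2 := @is_deriveZ R R R _ t u 1 _ (derivable_is_derive dpsi).
exact: (@is_deriveB _ _ _ _ _ _ _ _ _ H1 H2).
Qed.

Lemma C1_lin (phi psi : M -> R) (s t : R) :
  C1_fun phi -> C1_fun psi -> C1_fun (fun x => s * phi x - t * psi x).
Proof.
move=> Cphi Cpsi i u iu.
split; first exact: is_derive_derivable (C1_is_derive_lin s t Cphi Cpsi iu).
apply: (@near_eq_continuous _ _ (fun v => s * derive1 (phi \o cinv (ch i)) v -
    t * derive1 (psi \o cinv (ch i)) v)).
  have : \forall v \near u, cimg (ch i) v.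
    by apply: open_nbhs_nbhs; split => //; exact: cimg_open.
  by apply: filterS => v iv; apply/esym/is_derive_derive1/C1_is_derive_lin.
have [_ cphi] := Cphi i u iu; have [_ cpsi] := Cpsi i u iu.
by apply: cvgB; apply: cvgM; by [exact: cvg_cst|].
Qed.

Lemma grad_lin (phi psi : M -> R) (s t : R) (x : M) : C1_fun phi -> C1_fun psi ->
  grad G (fun x => s * phi x - t * psi x) x = s * grad G phi x - t * grad G psi x.
Proof.
move=> Cphi Cpsi; rewrite /grad.
have jx := cmap_img (chart_atP G x).
by rewrite (is_derive_derive1 (C1_is_derive_lin s t Cphi Cpsi jx)); ring.
Qed.

Lemma C1_continuous (phi : M -> R) : C1_fun phi -> continuous phi.
Proof.
move=> Cphi x; set j := chart_at G x.
have jx : cdom (ch j) x := chart_atP G x.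
have [/derivable_continuous cphi _] := Cphi j _ (cmap_img jx).
apply: (@near_eq_continuous _ _ ((phi \o cinv (ch j)) \o cmap (ch j))).
  have : \forall y \near x, cdom (ch j) y.
    by apply: open_nbhs_nbhs; split => //; exact: cdom_open.
  by apply: filterS => y jy /=; rewrite cmapK.
exact: (@continuous_comp _ _ _ (cmap (ch j)) (phi \o cinv (ch j)) x (cmap_continuous jx) cphi).
Qed.

Lemma grad_eq0 (phi : M -> R) (x : M) :
  (\forall y \near x, phi y = 0) -> grad G phi x = 0.
Proof.
move=> phi0; rewrite /grad; set j := chart_at G x.
have jx : cdom (ch j) x := chart_atP G x.
suff -> : derive1 (phi \o cinv (ch j)) (cmap (ch j) x) = 0 by rewrite mulr0.
apply: is_derive_derive1; apply: (@near_eq_is_derive R R R (cst 0)).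
have cx : {for cmap (ch j) x, continuous (cinv (ch j))}.
  by apply: cinv_continuous; exact: cmap_img.
have nphi : \forall u \near cmap (ch j) x, phi (cinv (ch j) u) = 0.
  by apply: (cx [set y | phi y = 0]); rewrite cmapK.
by apply: filterS nphi => u /= ->.
Qed.

Section in_arc_chart.
Variables (L : R) (W : set M) (sigma : M -> R) (gamma : R -> M).
Hypothesis hW : arc_chart G L W sigma gamma.

Lemma arc_pullback_derive (phi : M -> R) (s : R) (j : atlas G) :
  C1_fun phi -> `|s| < L -> cdom (ch j) (gamma s) ->
  is_derive s 1 (phi \o gamma) (derive1 (phi \o cinv (ch j)) (cmap (ch j) (gamma s)) *
                                derive1 (cmap (ch j) \o gamma) s).
Proof.
move=> Cphi sL js; have [Ws _ cs] := arc_sigmaK hW sL.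
have [dphi _] := Cphi j _ (cmap_img js).
have [dT _ _] := arc_gamma_unit hW sL js.
have := @is_derive1_comp _ (phi \o cinv (ch j)) (cmap (ch j) \o gamma) s _ _
  (derivable_is_derive dphi) (derivable_is_derive dT).
apply: near_eq_is_derive; apply: filterS (near_cdom cs js) => r jr /=.
by rewrite cmapK.
Qed.

(** The component of the gradient along the unit field of the arclength chart. *)
Lemma grad_arc (phi : M -> R) (x : M) : C1_fun phi -> W x ->
  darc G sigma x * grad G phi x = derive1 (phi \o gamma) (sigma x).
Proof.
move=> Cphi Wx; have [sL xK] := arc_gammaK hW Wx.
have jx : cdom (ch (chart_at G x)) (gamma (sigma x)) by rewrite xK; exact: chart_atP.
rewrite (is_derive_derive1 (arc_pullback_derive Cphi sL jx)).
have T1 := gamma_darc hW sL jx; rewrite !xK -/(darc G sigma x) in T1 *.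
have D0 := darc_neq0 hW Wx.
have g2 := @rinner_arc _ _ _ _ _ _ _ hW x 1 1 Wx; rewrite /rinner !mulr1 in g2.
rewrite /grad g2 invfM; set T' := derive1 _ _ in T1 *.
have -> : T' = (darc G sigma x)^-1 by rewrite -[T']mul1r -(mulVf D0) -mulrA T1 mulr1.
by rewrite mulrA mulrA divff// mul1r mulrC.
Qed.

Lemma arc_pullback_C1 (phi : M -> R) (s : R) : C1_fun phi -> `|s| < L ->
  {for s, continuous (derive1 (phi \o gamma))}.
Proof.
move=> Cphi sL; have [Ws _ cs] := arc_sigmaK hW sL.
set j := chart_at G (gamma s); have js : cdom (ch j) (gamma s) := chart_atP G (gamma s).
pose P := derive1 (phi \o cinv (ch j)); pose T := cmap (ch j) \o gamma.
apply: (@near_eq_continuous _ _ (fun r => P (T r) * derive1 T r)).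
  apply: filterS2 (near_norm_lt sL) (near_cdom cs js) => r rL jr.
  exact/esym/is_derive_derive1/arc_pullback_derive.
have [_ cP] := Cphi j _ (cmap_img js).
have [/derivable_continuous cT /derivable_continuous cT' _] := arc_gamma_unit hW sL js.
have cPT : {for s, continuous (P \o T)} by exact: (@continuous_comp R R R T P s cT cP).
by apply: cvgM; [exact: cPT|exact: cT'].
Qed.

Lemma grad_arc_continuous (phi : M -> R) (x : M) : C1_fun phi -> W x ->
  {for x, continuous (fun y => darc G sigma y * grad G phi y)}.
Proof.
move=> Cphi Wx; have [sL _] := arc_gammaK hW Wx.
apply: (@near_eq_continuous _ _ (derive1 (phi \o gamma) \o sigma)).
  have : \forall y \near x, W y by apply: open_nbhs_nbhs; split => //; exact: (arc_open hW).
  by apply: filterS => y Wy; rewrite grad_arc.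
exact: (@continuous_comp M R R sigma (derive1 (phi \o gamma)) x (sigma_continuous hW Wx)
  (arc_pullback_C1 Cphi sL)).
Qed.

End in_arc_chart.

(** Although the component of the gradient in the preferred charts need not be
    continuous, the density of the [H^1] norm is. *)
Lemma H1_density_continuous (phi : M -> R) : C1_fun phi ->
  continuous (fun x => rnorm G x (grad G phi x) ^+ 2 + 4 * phi x ^+ 2).
Proof.
move=> Cphi x; have [L [W [sigma [gamma [hW Wx _]]]]] := arc_chart_exists G x.
apply: (@near_eq_continuous _ _ (fun y => (darc G sigma y * grad G phi y) ^+ 2 + 4 * phi y ^+ 2)).
  have : \forall y \near x, W y by apply: open_nbhs_nbhs; split => //; exact: (arc_open hW).
  by apply: filterS => y Wy; rewrite (rnorm_arc hW)// real_normK ?num_real.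
have cg := grad_arc_continuous hW Cphi Wx; have cphi := C1_continuous Cphi (x := x).
apply: cvgD; first by apply: cvgM; exact: cg.
by apply: cvgM; [exact: cvg_cst|apply: cvgM; exact: cphi].
Qed.

(** The cone distance between the two exponentials is the norm of the difference of
    the tangent vectors, at all the points of the cone above [x] but the apex. *)
Definition cone_flat (phi psi : M -> R) (s t : R) (x : M) : Prop :=
  forall r : halfline R, 0 < nnval r ->
    cone_dist G
      (cone_exp G (cone_pt (x, r)) (s *: (cone_grad G phi (cone_pt (x, r)) : R^o * R^o)))
      (cone_exp G (cone_pt (x, r)) (t *: (cone_grad G psi (cone_pt (x, r)) : R^o * R^o)))
      ^+ 2 =
    nnval r ^+ 2 * (rnorm G x (s * grad G phi x - t * grad G psi x) ^+ 2 +
                    4 * (s * phi x - t * psi x) ^+ 2).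

Lemma cone_flat_arc (L : R) (W : set M) (sigma : M -> R) (gamma : R -> M)
    (phi psi : M -> R) (s t : R) (x : M) (d : R) :
  arc_chart G L W sigma gamma -> 0 < d -> 5 * d < L -> W x ->
  0 < 1 + 2 * s * phi x -> 0 < 1 + 2 * t * psi x ->
  `|sigma x| + `|atan (s * (darc G sigma x * grad G phi x) / (1 + 2 * s * phi x))| <= d ->
  `|sigma x| + `|atan (t * (darc G sigma x * grad G psi x) / (1 + 2 * t * psi x))| <= d ->
  cone_flat phi psi s t x.
Proof.
move=> hW d0 dL Wx p0 q0 pd qd r r0.
have gE (f : M -> R) (a : R) : a *: (cone_grad G f (cone_pt (x, r)) : R^o * R^o) =
    (a * grad G f x, nnval r * (2 * a * f x)).
  rewrite /cone_grad cone_repr_pt ?gt_eqF//; congr (_, _).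
  by rewrite /GRing.scale/=; ring.
rewrite !gE (cone_dist_arc hW (d := d))//.
- by congr (_ * _); rewrite addrC; congr (_ + _); ring.
- by rewrite mulrCA.
- by rewrite mulrCA.
Qed.

Lemma near_cone_flat (phi psi : M -> R) (p : M) : C1_fun phi -> C1_fun psi ->
  \forall x \near p & st \near nbhs (0 : R, 0 : R), cone_flat phi psi st.1 st.2 x.
Proof.
move=> Cphi Cpsi; have [L [W [sigma [gamma [hW Wp sp]]]]] := arc_chart_exists G p.
have L0 := arc_gt0 hW; pose d := L / 6.
have d0 : 0 < d by rewrite /d divr_gt0.
have dL : 5 * d < L by rewrite /d; lra.
pose z0 : M * (R * R) := (p, (0, 0)).
suff : \forall z \near z0, cone_flat phi psi z.2.1 z.2.2 z.1 by [].
(* The same estimate serves for both exponentials, with pr the choice of s or t. *)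
have base (f : M -> R) (pr : R * R -> R) : C1_fun f -> continuous pr -> pr (0, 0) = 0 ->
  \forall z \near z0, 0 < 1 + 2 * pr z.2 * f z.1 /\
    `|sigma z.1| + `|atan (pr z.2 * (darc G sigma z.1 * grad G f z.1) /
                            (1 + 2 * pr z.2 * f z.1))| <= d.
  move=> Cf cpr pr0.
  have comp1 (g : M -> R) : {for p, continuous g} ->
      {for z0, continuous (fun z : M * (R * R) => g z.1)}.
    by move=> cg; exact: (@continuous_comp _ M R fst g z0 cvg_fst cg).
  have c1 : {for z0, continuous (fun z : M * (R * R) => pr z.2)}.
    exact: (@continuous_comp _ _ R snd pr z0 cvg_snd (cpr _)).
  have cs := comp1 _ (sigma_continuous hW Wp).
  have cg := comp1 _ (grad_arc_continuous hW Cf Wp).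
  have cf := comp1 _ (C1_continuous Cf (x := p)).
  pose D (z : M * (R * R)) := 1 + 2 * pr z.2 * f z.1.
  have D0 : D z0 = 1 by rewrite /D /= pr0 mulr0 mul0r addr0.
  have cD : {for z0, continuous D}.
    apply: cvgD; first exact: cvg_cst.
    by apply: cvgM; [apply: cvgM; [exact: cvg_cst|exact: c1]|exact: cf].
  pose N (z : M * (R * R)) := pr z.2 * (darc G sigma z.1 * grad G f z.1) / D z.
  have cN : {for z0, continuous N}.
    apply: cvgM; first by apply: cvgM; [exact: c1|exact: cg].
    by apply: cvgV; [rewrite D0 oner_eq0|exact: cD].
  have N0 : N z0 = 0 by rewrite /N /= pr0 mul0r mul0r.
  have cA : {for z0, continuous (fun z => `|sigma z.1| + `|atan (N z)|)}.
    apply: cvgD; apply: cvg_norm; first exact: cs.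
    exact: (@continuous_comp _ _ _ N (@atan R) z0 cN (@continuous_atan R _)).
  apply: filterI.
    apply: (@near_preimage _ _ D z0 [set y | 0 < y]) => //.
    by rewrite /= D0.
  have : \forall z \near z0, `|sigma z.1| + `|atan (N z)| < d.
    apply: (@near_preimage _ _ (fun z => `|sigma z.1| + `|atan (N z)|) z0 [set y | y < d]) => //.
    by rewrite /= sp N0 atan0 normr0 addr0.
  by apply: filterS => z /ltW.
have nW : \forall z \near z0, W z.1.
  apply: (@near_preimage _ _ fst z0 W) => //; first exact: cvg_fst.
  exact: (arc_open hW).
have n1 := base phi fst Cphi _ erefl; have n2 := base psi snd Cpsi _ erefl.
apply: filterS3 nW (n1 _) (n2 _) => [z Wz [p1 pd] [q1 qd]||].
- exact: (cone_flat_arc hW d0 dL Wz p1 q1 pd qd).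
- move=> ?; exact: cvg_fst.
- move=> ?; exact: cvg_snd.
Qed.

(** Outside the supports the tangent vectors are zero, and no smallness of [s] and [t]
    is needed. *)
Lemma cone_flat_outside (phi psi : M -> R) (s t : R) (x : M) :
  (\forall y \near x, phi y = 0) -> (\forall y \near x, psi y = 0) ->
  cone_flat phi psi s t x.
Proof.
move=> phi0 psi0; have [L [W [sigma [gamma [hW Wx sx]]]]] := arc_chart_exists G x.
have L0 := arc_gt0 hW.
have px := nbhs_singleton phi0; have qx := nbhs_singleton psi0.
apply: (cone_flat_arc hW (d := L / 6)) => //.
- by rewrite divr_gt0.
- lra.
- by rewrite px mulr0 addr0.
- by rewrite qx mulr0 addr0.
- by rewrite (grad_eq0 phi0) !mulr0 mul0r atan0 sx normr0 addr0 divr_ge0 ?ltW.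
- by rewrite (grad_eq0 psi0) !mulr0 mul0r atan0 sx normr0 addr0 divr_ge0 ?ltW.
Qed.

Lemma near0_cone_flat (phi psi : M -> R) : test_function G phi -> test_function G psi ->
  \forall st \near nbhs (0 : R, 0 : R), forall x, cone_flat phi psi st.1 st.2 x.
Proof.
move=> [/smooth_C1 Cphi Kphi] [/smooth_C1 Cpsi Kpsi].
pose K := closure [set x | phi x != 0] `|` closure [set x | psi x != 0].
have : compact K by exact: compactU.
move=> /compact_near_coveringP/(_ _ (nbhs (0 : R, 0 : R))
  (fun st x => cone_flat phi psi st.1 st.2 x) _ (fun p _ => near_cone_flat p Cphi Cpsi)).
apply: filterS => st stK x; have [Kx|nKx] := pselect (K x); first exact: stK.
have out (f : M -> R) : ~ closure [set x | f x != 0] x -> \forall y \near x, f y = 0.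
  move=> nf; have : \forall y \near x, (~` closure [set x | f x != 0]) y.
    by apply: open_nbhs_nbhs; split => //; apply: closed_openC; exact: closed_closure.
  apply: filterS => y nfy; apply/eqP; apply/negPn/negP => fy; apply: nfy.
  exact: subset_closure.
by apply: cone_flat_outside; apply: out => Kx; apply: nKx; [left|right].
Qed.

End gradients.

Unset Implicit Arguments.
Set Strict Implicit.
Set Printing Implicit Defensive.

Theorem proposition5p7 (R : realType) (M : ptopologicalType)
  (G : riemannian1 R M) (mu : {finite_measure set (borel M) -> \bar R})
  (hmu : mu setT <> 0%E) (phi psi : M -> R)
  (hphi : test_function G phi) (hpsi : test_function G psi)
  (hL : 0 < Lambda G mu phi psi) :
  is_Sec_up G mu phi psi 0.
Proof.
have [/smooth_C1 Cphi _] := hphi; have [/smooth_C1 Cpsi _] := hpsi.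
move=> s t s0 t0 cs ct _.
apply: cvg_near_cst.
have cpair : (s j, t j) @[j --> \oo] --> (nbhs (0 : R), nbhs (0 : R)).
  by apply: cvg_pair; [exact: cs|exact: ct].
have nflat : \forall j \near \oo, forall x, cone_flat G phi psi (s j) (t j) x.
  have near0 := near0_cone_flat hphi hpsi.
  exact (cpair [set st : R * R | forall x, cone_flat G phi psi st.1 st.2 x] near0).
apply: filterS nflat => j flat; rewrite /sec_up_quotient.
pose h x := rnorm G x (grad G (fun y => s j * phi y - t j * psi y) x) ^+ 2 +
  4 * (s j * phi x - t j * psi x) ^+ 2.
rewrite (@Rintegral_hat_mu _ _ mu h)//; first by rewrite subrr mulr0.
- by move=> x; apply: addr_ge0; [exact: sqr_ge0|apply: mulr_ge0 => //; exact: sqr_ge0].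
- apply: measurable_continuous_borel.
  exact: (H1_density_continuous (C1_lin (s j) (t j) Cphi Cpsi)).
move=> x r; rewrite /h grad_lin//.
have [r0|r0] := eqVneq (nnval r) 0; last first.
  by apply: flat; rewrite lt_neqAle eq_sym r0 /nnval ge0.
by rewrite r0 expr0n mul0r; exact: cone_dist_apex.
Qed.
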